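(* Let $n,r,m,d,k$ be positive integers with $n=rm=dk$. Set \[ {\rm Par}(m;d,r)=\{\mu=(\mu_1,\ldots,\mu_{l(\mu)})\vdash m:\ \mu_i\mid d\mid r\mu_i \text{ for all } i\in[l(\mu)]\}. \] Then \[ \sum_{j=0}^{n-1}\chi^{Q_{r^m,j}}_{d^k}t^j=\sum_{\mu\in{\rm Par}(m;d,r)}\pi_{\frac rd\mu}\prod_{i=1}^{l(\mu)}\Big(tA_{\frac rd\mu_i-1}(t)[d]_t^{\frac rd\mu_i}\Big)_{d,\mu_i}. \]
   Context: $r^m$ denotes the partition of $n$ with $m$ parts equal to $r$ (similarly $d^k$). For a partition $\mu$ and rational $q$ with all $q\mu_i$ positive integers, $q\mu=(q\mu_1,\dots,q\mu_{l(\mu)})$. For a partition $\nu$ of $N$ with parts $\nu_1,\dots,\nu_l$, $\pi_\nu=\binom{N}{\nu_1,\dots,\nu_l}\big/\prod_{j\ge1}m_j(\nu)!$, where $m_j(\nu)$ is the number of parts equal to $j$. $A_s(t)=\sum_{\sigma\in S_s}t^{{\rm exc}(\sigma)}$ ($A_0=1$), with ${\rm exc}(\sigma)=|{\rm Exc}(\sigma)|$, ${\rm Exc}(\sigma)=\{i\in[s-1]:i\sigma>i\}$. $[d]_t=1+t+\cdots+t^{d-1}$. For $f(t)=\sum_ia_it^i$, $f(t)_{b,c}=\sum_{i:\gcd(i,b)=c}a_it^i$ (with $\gcd(0,b)=b$). For a partition $\lambda$ of $n$ and $j$, $S_{\lambda,j}$ is the set of $\sigma\in S_n$ of cycle type $\lambda$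 with ${\rm exc}(\sigma)=j$. For $\sigma\in S_n$, $w(\sigma)$ is obtained from $\sigma_1\cdots\sigma_n$ ($\sigma_i=i\sigma$) by replacing $\sigma_i$ with $\overline{\sigma_i}$ when $i\in{\rm Exc}(\sigma)$; with letter order $\overline1<\cdots<\overline n<1<\cdots<n$, ${\rm Dex}(\sigma)=\{i\in[n-1]:w_i>w_{i+1}\}$. $F_S=\sum x_{j_1}\cdots x_{j_n}$ over $j_1\ge\cdots\ge j_n\ge1$ with $j_i>j_{i+1}$ for $i\in S$. $Q_{\lambda,j}=\sum_{\sigma\in S_{\lambda,j}}F_{{\rm Dex}(\sigma)}$, a homogeneous symmetric function of degree $n$. For such $F$, $\chi^F_\nu$ is defined by $F=\sum_{\nu\vdash n}\chi^F_\nu z_\nu^{-1}{\sf p}_\nu$, with ${\sf p}_\nu$ the power sum and $z_\nu=\prod_ii^{m_i(\nu)}m_i(\nu)!$.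
   Formalization: The formal theorem assumes r ≥ 2 instead of r ≥ 1; for r = 1 the stated identity always fails, since the left side is 1 (only the identity permutation, with no excedances) while the right side is t^n. *)

(* Defs.v *)
From Stdlib Require Import ClassicalEpsilon.
From HB Require Import structures.
From mathcomp Require Import all_boot all_order all_fingroup all_algebra.
From mathcomp Require Import mpoly.

Set Implicit Arguments.
Unset Strict Implicit.
Unset Printing Implicit Defensive.

Import GRing.Theory.
Local Open Scope ring_scope.

Definition is_partn (n : nat) (s : seq nat) : bool :=
  [&& sorted geq s, 0%N \notin s & sumn s == n].

(* Partitions of n are the n-tuples with entries in [0, n] with zeros removed;
   see mem_partns. *)
Definition partns (n : nat) : seq (seq nat) :=
  undup [seq s <- [seq [seq a <- map val t | (0 < a)%N] | t : n.-tuple 'I_n.+1]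
        | is_partn n s].

Lemma partns_uniq n : uniq (partns n).
Proof. exact: undup_uniq. Qed.

Lemma mem_partns n s : (s \in partns n) = is_partn n s.
Proof.
rewrite mem_undup mem_filter andb_idr // => Hs.
have /and3P[_ s0 /eqP Hn] := Hs.
have s_pos a : a \in s -> (0 < a)%N.
  by rewrite lt0n; apply: contraTneq => ->.
have s_size : (size s <= n)%N.
  rewrite -Hn; elim: s s_pos {Hs s0 Hn} => //= a s IHs s_pos.
  rewrite -add1n leq_add ?s_pos ?mem_head // IHs // => b bs.
  by rewrite s_pos // inE bs orbT.
have s_le a : a \in s -> (a < n.+1)%N.
  rewrite ltnS -Hn; elim: s {Hs s0 Hn s_pos s_size} => //= b s IHs.
  rewrite inE => /predU1P[->|/IHs le_as]; first exact: leq_addr.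
  by rewrite (leq_trans le_as) ?leq_addl.
pose u : seq 'I_n.+1 := map inord s ++ nseq (n - size s) ord0.
have u_size : size u == n by rewrite size_cat size_map size_nseq subnKC.
have Hu : s = [seq a <- map val (Tuple u_size) | (0 < a)%N].
  rewrite /= map_cat filter_cat map_nseq filter_nseq /= cats0 -map_comp.
  have <- : s = [seq (val \o @inord n) a | a <- s].
    apply: esym; rewrite -[RHS]map_id; apply/eq_in_map => a a_s /=.
    by rewrite inordK ?s_le.
  apply: esym; rewrite -[RHS]filter_predT.
  by apply: eq_in_filter => a /s_pos ->.
by apply/imageP; exists (Tuple u_size).
Qed.

Definition zee (nu : seq nat) : nat :=
  (\prod_(1 <= i < (sumn nu).+1) (i ^ count_mem i nu * (count_mem i nu)`!))%N.

Definition ppi (nu : seq nat) : rat :=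
  (sumn nu)`!%:R / (\prod_(a <- nu) a`!)%N%:R
    / (\prod_(1 <= j < (sumn nu).+1) (count_mem j nu)`!)%N%:R.

Definition Par (m d r : nat) : seq (seq nat) :=
  [seq mu <- partns m | all (fun a => (a %| d) && (d %| r * a))%N mu].

(* The set [n] is 'I_n, so positions and values are shifted down by one. *)

Definition exc (n : nat) (s : 'S_n) : nat := #|[set i : 'I_n | (i < s i)%N]|.

Definition cycle_type (n : nat) (s : 'S_n) : seq nat :=
  sort geq [seq #|c| | c : {set 'I_n} in porbits s].

(* The barred letter a is encoded by a and the plain letter a by n + a, so that
   < on nat is the order of the letters. *)
Definition wletter (n : nat) (s : 'S_n) (i : 'I_n) : nat :=
  if (i < s i)%N then s i : nat else (n + s i)%N.

Definition Dex (n : nat) (s : 'S_n) : {set 'I_n} :=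
  [set i : 'I_n | [exists i' : 'I_n,
     (i' == i.+1 :> nat) && (wletter s i' < wletter s i)%N]].

Definition Scycexc (n : nat) (lam : seq nat) (j : nat) : {set 'S_n} :=
  [set s : 'S_n | (cycle_type s == lam) && (exc s == j)].

(* A power series of bounded degree in x_1, x_2, ... is given by its images
   under x_i |-> 0 (i > N), for all N, as in the inverse limit description of
   the ring of symmetric functions.  The variable x_{i+1} is 'X_i. *)
Definition qfun := forall N : nat, {mpoly rat[N]}.

Definition Fqsym (n : nat) (S : {set 'I_n}) : qfun := fun N =>
  \sum_(f : {ffun 'I_n -> 'I_N} |
        [forall i : 'I_n, forall i' : 'I_n, (i' == i.+1 :> nat) ==>
           (if i \in S then (f i' < f i)%N else (f i' <= f i)%N)])
    \prod_(i < n) 'X_(f i).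

Definition Qeul (n : nat) (lam : seq nat) (j : nat) : qfun := fun N =>
  \sum_(s in Scycexc n lam j) Fqsym (Dex s) N.

Definition psum (nu : seq nat) : qfun := fun N =>
  \prod_(a <- nu) \sum_(i < N) 'X_i ^+ a.

Definition is_pexpansion (n : nat) (F : qfun) (c : seq nat -> rat) : Prop :=
  forall N, F N = \sum_(nu <- partns n) (c nu / (zee nu)%:R) *: psum nu N.

(* The coefficients exist and are unique on partitions of n when F is
   symmetric and homogeneous of degree n. *)
Definition chi (n : nat) (F : qfun) : seq nat -> rat :=
  epsilon (inhabits (fun _ => 0)) (is_pexpansion n F).

Definition eulerian (s : nat) : {poly rat} := \sum_(w : 'S_s) 'X^(exc w).

Definition tint (d : nat) : {poly rat} := \sum_(i < d) 'X^i.

Definition gcd_part (f : {poly rat}) (b c : nat) : {poly rat} :=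
  \poly_(i < size f) (if gcdn i b == c then f`_i else 0).

(* Main.v *)
From Stdlib Require Import ClassicalEpsilon.
From HB Require Import structures.
Require Import Defs.
From mathcomp Require Import all_boot all_order all_fingroup all_algebra.
From mathcomp Require Import all_field mpoly ring zify.

(** A pair of a permutation s of cycle type r^m and a monomial of F_(Dex s) is
    the same as a multiset of m primitive necklaces of length r over two-coloured
    letters, in which a red letter is followed by a letter of smaller or equal
    value and a blue one by a letter of larger or equal value (the bijection of
    Gessel-Reutenauer and Shareshian-Wachs); red letters are the excedances.
    Hence the generating function of the Q_(r^m,j) is h_m[L_r], where L_r
    counts the primitive necklaces, and it obeys Newton's recursion
    r m U_m = sum_i P_r(x^i, t^i) U_(m-i) with P_r counting primitive cyclic words.
    All cyclic words are powers of primitive ones, and they are counted by the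
    trace of a power of a transfer matrix which is triangular up to a rank one
    term, which yields recursions expressing them in the power sums.
    Along p_j -> [j = d] these recursions are solved by Eulerian polynomials:
    the cyclic words of length f g give f g (t A_(g-1)(t) [f]_t^g + [g = 1]) / (f^g g!)
    at p_f = 1.  Since i^(g-1) is the Taylor coefficient of t A_(g-1)(t) / (1-t)^g,
    passing to the coefficients of exponent divisible by e in t A_(g-1)(t) [d]_t^g
    replaces d by d/e, t by t^e and multiplies by e^(g-1), so that the primitive
    words pick the exponents i with a prescribed gcd(i, d).  The sum over
    partitions is h_m = sum_mu z_mu^-1 p_mu. *)

Set Implicit Arguments.
Unset Strict Implicit.
Unset Printing Implicit Defensive.

Import Order.TTheory GRing.Theory Num.Theory.
Local Open Scope ring_scope.

(** * Eulerian polynomials *)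

(** Generating functions enter only as recursions between coefficients, each valid for every number
    N of variables. The predicate [pexp] carries along such a recursion a power sum polynomial
    independent of N together with its value at p_d = 1, p_j = 0 otherwise; the character values are
    the coefficients of that value times d^k k!. Since [chi] is a choice among expansions, its value
    at d^k is pinned down at the end by evaluating at algebraic numbers with these power sums. The
    delicate point of the bijection is repeated words: positions with equal words are matched by
    their rank, and this rank matching is what makes the words primitive. The hypothesis r > 1 is
    essential. A word of length one is primitive in both colours, whereas a fixed point is never an
    excedance; and for r = 1 the left side is 1 while the right side is t^n. *)

Lemma excE n (s : 'S_n) : exc s = (\sum_(k < n) (k < s k))%N.
Proof.
rewrite /exc -sum1_card big_mkcond /=; apply: eq_bigr => k _.
by rewrite inE; case: (k < s k)%N.
Qed.

(** Inserts the new maximum into the cycle of [i], between [i] and its image; [i = ord_max] makes it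
    a fixed point. Only the excedance status of [i] can change. *)
Definition insert_max n (p : 'I_n.+1 * 'S_n) : 'S_n.+1 :=
  (tperm p.1 ord_max * lift_perm ord_max ord_max p.2)%g.

Lemma insert_max_inj n : injective (@insert_max n).
Proof.
have max_at p : @insert_max n p p.1 = ord_max.
  by rewrite permM tpermL lift_perm_id.
move=> [i s] [i' s'] E.
have /= Ei := max_at (i, s); have := max_at (i', s'); rewrite -E /= -Ei.
move/perm_inj => Eii; subst i'; congr pair.
have /mulgI H : (tperm i ord_max * lift_perm ord_max ord_max s =
  tperm i ord_max * lift_perm ord_max ord_max s')%g := E.
apply/permP => k; apply: (@lift_inj _ ord_max).
by rewrite -!(lift_perm_lift ord_max) H.
Qed.

Lemma insert_max_bij n : bijective (@insert_max n).
Proof.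
apply: inj_card_bij; first exact: insert_max_inj.
by rewrite card_prod !card_Sn card_ord factS.
Qed.

Lemma exc_insert_max n (i : 'I_n.+1) (s : 'S_n) :
  exc (insert_max (i, s)) =
  (if unlift ord_max i is Some j then ~~ (j < s j) + exc s else exc s)%N.
Proof.
have max_lift (k : 'I_n) : widen_ord (leqnSn n) k = lift ord_max k.
  by apply: val_inj; rewrite /= /bump leqNgt ltn_ord.
have lt_max (k : 'I_n.+1) : (n < k)%N = false by rewrite ltnNge -ltnS ltn_ord.
rewrite !excE big_ord_recr /= lt_max addn0.
have val_lift (k : 'I_n) : lift ord_max k = k :> nat.
  by rewrite /= /bump leqNgt ltn_ord.
case: unliftP => [j ->|->] /=.
- rewrite (bigD1 j) //= [in RHS](bigD1 j) //= addnA addnC [RHS]addnC; congr addn.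
    apply: eq_bigr => k kj; rewrite permM max_lift tpermD ?(inj_eq lift_inj) //.
    - by rewrite lift_perm_lift val_lift.
    - by rewrite eq_sym.
    - by rewrite neq_lift.
  rewrite permM max_lift tpermL lift_perm_id /= ltn_ord.
  by case: (j < s j)%N.
- apply: eq_bigr => k _.
  by rewrite permM max_lift tperm1 perm1 lift_perm_lift val_lift.
Qed.

(** Of the n + 1 insertions into s, exc s + 1 keep the number of excedances and n - exc s raise it
    by one; the derivative supplies the factor exc s. *)
Lemma eulerianS n : eulerian n.+1 =
  (1 + n%:R *: 'X) * eulerian n + 'X * (1 - 'X) * (eulerian n)^`().
Proof.
rewrite {1}/eulerian (reindex (@insert_max n)) /=; last first.
  exact: onW_bij (@insert_max_bij n).
rewrite (eq_bigr (fun p => 'X^(exc (insert_max (p.1, p.2))))); last by case.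
rewrite -(pair_bigA _ (fun i s => 'X^(exc (insert_max (i, s))))) /= exchange_big /=.
rewrite /eulerian raddf_sum !mulr_sumr -big_split /=; apply: eq_bigr => s _.
rewrite big_ord_recr /= exc_insert_max unlift_none.
rewrite (eq_bigr (fun j : 'I_n => 'X^(~~ (j < s j)%N + exc s))); last first.
  move=> j _; have -> : widen_ord (leqnSn n) j = lift ord_max j.
    by apply: val_inj; rewrite /= /bump leqNgt ltn_ord.
  by rewrite exc_insert_max liftK.
have -> : \sum_(j < n) 'X^(~~ (j < s j)%N + exc s) =
    \sum_(j < n) ('X * 'X^(exc s) + (j < s j)%:R *: ('X^(exc s) - 'X * 'X^(exc s)))
    :> {poly rat}.
  apply: eq_bigr => j _; case: (j < s j)%N; rewrite /= ?scale1r ?scale0r ?addr0.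
    by rewrite add0n addrC subrK.
  by rewrite add1n exprS.
rewrite big_split /= sumr_const card_ord -scaler_suml -natr_sum -excE.
rewrite derivXn -mulr_natl -scaler_nat -[X in _ + X]mul1r.
case: (exc s) => [|e]; rewrite /= ?mulr0n ?scale0r ?expr0 ?mulr0.
  by rewrite -!mul_polyC !polyCMn; ring.
by rewrite exprS -!mul_polyC !rmorph_nat; ring.
Qed.

(* Worpitzky: A_n(t) / (1 - t)^(n+1) = sum_i (i+1)^n t^i, modulo t^M. *)
Lemma worpitzky n M : exists B, eulerian n =
  (1 - 'X) ^+ n.+1 * \poly_(i < M) (i.+1%:R ^+ n) + 'X^M * B.
Proof.
elim: n => [|n [B EB]].
  exists 1; rewrite /eulerian expr1 mulr1.
  have -> : \sum_(w : 'S_0) 'X^(exc w) = 1 :> {poly rat}.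
    rewrite (eq_bigr (fun _ => 1)) ?sumr_const ?card_Sn // => w _.
    by rewrite excE big_ord0.
  have -> : \poly_(i < M) (i.+1%:R ^+ 0) = \sum_(i < M) 'X^i :> {poly rat}.
    by rewrite poly_def; apply: eq_bigr => i _; rewrite expr0 scale1r.
  by rewrite -opprB mulNr -subrX1 opprB subrK.
set S := \poly_(i < M) _ in EB.
have -> : \poly_(i < M) (i.+1%:R ^+ n.+1) = S + 'X * S^`() :> {poly rat}.
  apply/polyP => i; rewrite coefD coefXM coef_deriv !coef_poly.
  case: i => [|i] /=; first by rewrite addr0 !expr1n.
  case: ifP => _; last by rewrite mul0rn addr0.
  by rewrite -mulrS exprSr mulr_natr.
(* The right side of [eulerianS] applied to the remainder X^M B: the factor X in front of the
   derivative restores the power X^M. *)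
exists ((1 + n%:R *: 'X) * B + (1 - 'X) * (M%:R * B + 'X * B^`())).
rewrite eulerianS EB; clear EB; clearbody S.
rewrite derivD !derivM deriv_exp derivB derivX derivXn (derivC 1) /= -mul_polyC.
rewrite rmorph_nat !exprS; move: ((1 - 'X) ^+ n) => Q.
case: M => [|M] /=; rewrite ?mulr0n ?expr0 ?exprS.
  by ring.
by move: ('X^M) => Z; ring.
Qed.

Lemma worpitzky_dvd n M : 'X^M %|
  eulerian n - (1 - 'X) ^+ n.+1 * \poly_(i < M) (i.+1%:R ^+ n).
Proof.
by have [B ->] := worpitzky n M; rewrite addrC addKr dvdp_mulr.
Qed.

Lemma dvdXn_all_eq0 (p : {poly rat}) : (forall M, 'X^M %| p) -> p = 0.
Proof.
move=> H; apply/polyP => i; rewrite coef0.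
have /dvdpP[q ->] := H i.+1.
by rewrite coefMXn ltnS leqnn.
Qed.

(** Through Worpitzky's series and after division by (1 - t)^n, this is the binomial expansion of
    i^n = ((i + 1) - 1)^n in each coefficient. The convolution shape is the one that the recursion
    of [openw] produces. *)
Lemma eulerian_binomial_rec n : (0 < n)%N -> eulerian n =
  \sum_(l < n) 'C(n, l.+1)%:R * ('X - 1) ^+ l * eulerian (n.-1 - l).
Proof.
move=> n_gt0; apply/eqP; rewrite -subr_eq0; apply/eqP/dvdXn_all_eq0 => M.
pose S k : {poly rat} := \poly_(i < M) (i.+1%:R ^+ k).
pose E k := eulerian k - (1 - 'X) ^+ k.+1 * S k.
have dvdE k : 'X^M %| E k by exact: worpitzky_dvd.
have eqE k : eulerian k = E k + (1 - 'X) ^+ k.+1 * S k by rewrite subrK.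
(* The truncated series leave a single boundary term, the coefficient -M^n in degree M. *)
have bracket : (1 - 'X) * S n - \sum_(l < n) 'C(n, l.+1)%:R * (-1) ^+ l * S (n.-1 - l)%N
    = 'X^M * (- (M%:R ^+ n))%:P.
  apply/polyP => i; rewrite coefB mulrBl mul1r coefB coefXM coefXnM coefC coef_sum.
  rewrite (eq_bigr (fun l : 'I_n => if (i < M)%N then
     ('C(n, l.+1)%:R * (-1) ^+ l * i.+1%:R ^+ (n.-1 - l)) else 0)); last first.
    move=> l _; rewrite -(rmorph_nat (@polyC rat)) -(rmorphN1 (@polyC rat)).
    by rewrite -rmorphXn -rmorphM coefCM coef_poly; case: ifP; rewrite ?mulr0.
  rewrite !coef_poly; case: ltngtP => [iM|iM|iM].
  - have -> : (if i == 0%N then 0 else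
       if (i.-1 < M)%N then i.-1.+1%:R ^+ n else 0) = i%:R ^+ n :> rat.
      by case: i iM => [_|i iM] /=; rewrite ?expr0n ?gtn_eqF // ltnW.
    have -> : i%:R = i.+1%:R - 1 :> rat by rewrite mulrSr addrK.
    rewrite exprBn big_ord_recl subn0 !expr0 mulr1 mul1r bin0 mulr1n.
    rewrite opprD addrA subrr sub0r -opprD -big_split big1 ?oppr0 //= => l _.
    rewrite expr1n mulr1 /bump /= add1n exprS mulN1r.
    have -> : (n - l.+1 = n.-1 - l)%N by lia.
    by rewrite mulNr mulNrn -mulr_natr; ring.
  - rewrite big1_eq subr0 sub0r; case: i iM => [|i] // iM; rewrite /= ltnNge -ltnS iM oppr0.
    by rewrite subn_eq0 leqNgt iM.
  - rewrite iM big1_eq subr0 sub0r subnn eqxx.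
    by case: M {S E dvdE eqE} i iM => [_ _|M _ _] /=; rewrite ?expr0n ?gtn_eqF ?ltnSn.
have -> : eulerian n -
    \sum_(l < n) 'C(n, l.+1)%:R * ('X - 1) ^+ l * eulerian (n.-1 - l) =
  E n - \sum_(l < n) 'C(n, l.+1)%:R * ('X - 1) ^+ l * E (n.-1 - l)%N
   + (1 - 'X) ^+ n * 'X^M * (- (M%:R ^+ n))%:P.
  rewrite -mulrA -bracket [X in X - _ = _]eqE.
  have -> : \sum_(l < n) 'C(n, l.+1)%:R * ('X - 1) ^+ l * eulerian (n.-1 - l) =
    \sum_(l < n) 'C(n, l.+1)%:R * ('X - 1) ^+ l * E (n.-1 - l)%N
    + (1 - 'X) ^+ n * \sum_(l < n) 'C(n, l.+1)%:R * (-1) ^+ l * S (n.-1 - l)%N.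
    rewrite mulr_sumr -big_split /=; apply: eq_bigr => l _.
    rewrite [in LHS]eqE mulrDr; congr (_ + _).
    have -> : (1 - 'X : {poly rat}) ^+ n = (1 - 'X) ^+ l * (1 - 'X) ^+ (n.-1 - l).+1.
      by rewrite -exprD; congr (_ ^+ _); have := ltn_ord l; lia.
    have -> : ('X - 1 : {poly rat}) ^+ l = (-1) ^+ l * (1 - 'X) ^+ l.
      by rewrite -exprMn mulN1r opprB.
    by ring.
  by rewrite exprSr; ring.
apply: dvdp_add; last by rewrite dvdp_mulr ?dvdp_mull.
apply: dvdp_sub; first exact: dvdE.
by elim/big_ind: _ => [|p q|l _]; rewrite ?dvdp0 ?dvdp_mull //; exact: dvdp_add.
Qed.

(* For g > 0 this is (1 - t^d)^g sum_(i > 0) i^(g-1) t^i. *)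
Definition tAq d g : {poly rat} := 'X * eulerian g.-1 * tint d ^+ g.

(** Expand (1 - t^d)^g against the series of i^(g-1). The strict bound matters for g = 1: the series
    starts at i = 1, while 0^0 would count as 1. *)
Lemma coef_tAq d g j : (0 < g)%N -> (tAq d g)`_j =
  \sum_(l < g.+1 | (d * l < j)%N) (-1) ^+ l * 'C(g, l)%:R * (j - d * l)%:R ^+ g.-1.
Proof.
case: g => // g _; rewrite /tAq /=.
have [B ->] := worpitzky g j; set S := \poly_(i < j) _.
have -> : 'X * ((1 - 'X) ^+ g.+1 * S + 'X^j * B) * tint d ^+ g.+1 =
   'X^(j.+1) * (B * tint d ^+ g.+1) + (1 - 'X^d) ^+ g.+1 * ('X * S).
  have -> : 1 - 'X^d = (1 - 'X) * tint d :> {poly rat}.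
    by rewrite -opprB -[1 - 'X]opprB mulNr -subrX1.
  by rewrite exprMn ['X^(j.+1)]exprS; ring.
rewrite coefD coefXnM ltnS leqnn add0r exprBn mulr_suml coef_sum [RHS]big_mkcond /=.
apply: eq_bigr => l _; rewrite expr1n mulr1 -exprM.
have -> : ((-1) ^+ l * 'X^(d * l) *+ 'C(g.+1, l) * ('X * S)) =
  ((-1) ^+ l * 'C(g.+1, l)%:R)%:P * ('X^(d * l) * ('X * S)).
  by rewrite rmorphM rmorphXn rmorphN1 rmorph_nat -mulr_natr; ring.
rewrite coefCM coefXnM coefXM coef_poly.
case: ltngtP => [dj|dj|<-]; rewrite ?subnn ?mulr0 //.
have -> : (j - d * l == 0)%N = false by apply/eqP; lia.
have -> : ((j - d * l).-1 < j)%N by lia.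
by rewrite prednK //; lia.
Qed.

(** In [coef_tAq] the summand is homogeneous of degree g - 1 in (d, j), and scaling both leaves the
    range of l unchanged. *)
Lemma coef_tAq_mul d e g j : (0 < g)%N -> (0 < e)%N ->
  (tAq (e * d) g)`_(e * j) = e%:R ^+ g.-1 * (tAq d g)`_j.
Proof.
move=> g_gt0 e_gt0; rewrite !coef_tAq // mulr_sumr.
apply: eq_big => [l|l _]; first by rewrite -mulnA ltn_pmul2l.
by rewrite -mulnA -mulnBr natrM exprMn; ring.
Qed.

(** * Words, codes and rotations *)

(* (a, false) is red and (a, true) is blue; the values are numbered in decreasing
   order, so that the code 2 a + b increases along the positions of a permutation. *)
Notation letter N := ('I_N * bool)%type.

Definition letter_code N (a : letter N) : nat := (a.1.*2 + a.2)%N.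

Lemma letter_code_inj N : injective (@letter_code N).
Proof.
move=> [a b] [a' b']; rewrite /letter_code /= => E.
have Eb : b = b' by case: b b' E => [] [] //; lia.
by subst b'; congr pair; apply: val_inj => /=; move: E; rewrite -!muln2; lia.
Qed.

Lemma ltn_letter_code N (a : letter N) : (letter_code a < N.*2)%N.
Proof. by case: a => [a b]; rewrite /letter_code /=; have := ltn_ord a; case: b; lia. Qed.

Definition allowed N (a b : letter N) : bool :=
  if a.2 then (b.1 <= a.1)%N else (a.1 <= b.1)%N.

Lemma allowed_letter_code N (a b : letter N) :
  allowed a b = if a.2 then (letter_code b <= letter_code a)%N else (letter_code a <= letter_code b)%N.
Proof.
case: a b => [a []] [b []]; rewrite /allowed /letter_code /=; apply/idP/idP; lia.
Qed.

(** The first n letters are read as digits in base 2N, so that lexicographic order becomes the order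
    of nat. *)
Fixpoint prefix_code N n (g : nat -> letter N) : nat :=
  if n is n'.+1 then (letter_code (g 0) * N.*2 ^ n' + prefix_code n' (fun k => g k.+1))%N else 0%N.

Lemma eq_prefix_code N n (g h : nat -> letter N) :
  (forall k, (k < n)%N -> g k = h k) -> prefix_code n g = prefix_code n h.
Proof.
elim: n g h => //= n IHn g h E; rewrite E //; congr (_ + _)%N.
by apply: IHn => k kn; rewrite E.
Qed.

Lemma ltn_prefix_code N n (g : nat -> letter N) : (prefix_code n g < N.*2 ^ n)%N.
Proof.
elim: n g => [|n IHn] g; first by rewrite expn0.
rewrite /= expnS; have := IHn (fun k => g k.+1); have := ltn_letter_code (g 0%N).
by move: (prefix_code _ _) (N.*2 ^ n)%N => u v; nia.
Qed.

Lemma prefix_code_lt N n (g h : nat -> letter N) :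
  (letter_code (g 0) < letter_code (h 0))%N -> (prefix_code n.+1 g < prefix_code n.+1 h)%N.
Proof.
move=> lt_gh /=; have := ltn_prefix_code n (fun k => g k.+1).
by move: (prefix_code _ _) (prefix_code _ _) (N.*2 ^ n)%N => u v w; nia.
Qed.

Lemma prefix_code_inj N n (g h : nat -> letter N) :
  prefix_code n g = prefix_code n h -> forall k, (k < n)%N -> g k = h k.
Proof.
elim: n g h => // n IHn g h E.
have E0 : letter_code (g 0) = letter_code (h 0).
  by case: (ltngtP (letter_code (g 0)) (letter_code (h 0))) => // /(@prefix_code_lt _ n); rewrite E ltnn.
move: E; rewrite /= E0 => /addnI E [_|k kn]; first exact: letter_code_inj.
exact: (IHn _ _ E k).
Qed.

(** As long as consecutive letters agree the colour persists, and the first change goes in the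
    direction of that colour. So a word starting with red does not fall under rotation and one
    starting with blue does not rise; this is how colours encode excedances. *)
Lemma prefix_code_allowed N n (g : nat -> letter N) :
  (forall k, allowed (g k) (g k.+1)) ->
  if (g 0).2 then (prefix_code n (fun k => g k.+1) <= prefix_code n g)%N
  else (prefix_code n g <= prefix_code n (fun k => g k.+1))%N.
Proof.
elim: n g => [|n IHn] g gP; first by case: ifP.
have := IHn (fun k => g k.+1) (fun k => gP k.+1).
have := gP 0; rewrite allowed_letter_code.
case: (ltngtP (letter_code (g 0)) (letter_code (g 1))) => [lt|lt|/letter_code_inj E] g01 IH.
- by case: ifP g01 => // _ _; rewrite ltnW // prefix_code_lt.
- by case: ifP g01 => // _ _; rewrite ltnW // prefix_code_lt.
- by move: IH; rewrite /= -E; case: ifP => _; rewrite leq_add2l.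
Qed.

(* Words have length s.+1 and are read cyclically. *)
Definition word N s := {ffun 'I_s.+1 -> letter N}.

Section Words.
Variables N s : nat.
Implicit Types w : word N s.

Definition letter_at w (k : nat) : letter N := w (inord (k %% s.+1)).

Lemma letter_at_mod w k : letter_at w (k %% s.+1) = letter_at w k.
Proof. by rewrite /letter_at modn_mod. Qed.

Lemma letter_at_ord w (k : 'I_s.+1) : letter_at w k = w k.
Proof. by rewrite /letter_at modn_small // inord_val. Qed.

Lemma word_eq w w' : (forall k, (k < s.+1)%N -> letter_at w k = letter_at w' k) -> w = w'.
Proof. by move=> E; apply/ffunP => k; rewrite -!letter_at_ord E. Qed.

Definition rotw w : word N s := [ffun k : 'I_s.+1 => letter_at w k.+1].

Lemma letter_at_rotw w k : letter_at (rotw w) k = letter_at w k.+1.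
Proof.
rewrite {1}/letter_at ffunE inordK ?ltn_mod // -letter_at_mod -addn1 modnDml addn1.
by rewrite letter_at_mod.
Qed.

Lemma letter_at_iter w j k : letter_at (iter j rotw w) k = letter_at w (k + j).
Proof.
by elim: j k => [|j IHj] k; rewrite ?addn0 // iterS letter_at_rotw IHj addSnnS.
Qed.

Lemma iter_rotw_size w : iter s.+1 rotw w = w.
Proof.
by apply: word_eq => k _; rewrite letter_at_iter /letter_at modnDr.
Qed.

Lemma rotw_inj : injective rotw.
Proof.
by move=> w w' E; rewrite -(iter_rotw_size w) -(iter_rotw_size w') !iterSr E.
Qed.

Definition allowedw w := [forall k : 'I_s.+1, allowed (letter_at w k) (letter_at w k.+1)].

Lemma allowedwP w :
  reflect (forall k, allowed (letter_at w k) (letter_at w k.+1)) (allowedw w).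
Proof.
apply: (iffP forallP) => H k; last exact: H.
have := H (Ordinal (ltn_pmod k (ltn0Sn s))); rewrite /= letter_at_mod.
by rewrite -[in X in _ -> X](letter_at_mod w k.+1) -[k.+1]addn1 -modnDml addn1 letter_at_mod.
Qed.

Definition prim w := [forall k : 'I_s.+1, (0 < k)%N ==> (iter k rotw w != w)].

Lemma primP w : reflect (forall k, (0 < k < s.+1)%N -> iter k rotw w <> w) (prim w).
Proof.
apply: (iffP forallP) => [H k /andP[k0 ks]|H k].
  by have /implyP/(_ k0)/eqP := H (Ordinal ks).
by apply/implyP => k0; apply/eqP; apply: H; rewrite k0 ltn_ord.
Qed.

Definition code w := prefix_code s.+1 (letter_at w).

Lemma code_inj : injective code.
Proof. by move=> w w' /prefix_code_inj E; apply: word_eq. Qed.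

Lemma code_rotw w : code (rotw w) = prefix_code s.+1 (fun k => letter_at w k.+1).
Proof. by apply: eq_prefix_code => k _; rewrite letter_at_rotw. Qed.

Lemma allowedw_rotw w : allowedw w -> allowedw (rotw w).
Proof. by move/allowedwP => H; apply/allowedwP => k; rewrite !letter_at_rotw. Qed.

Definition good w := allowedw w && prim w.

End Words.
Arguments rotw {N s}.

(** * Permutations compatible with a weight *)

Lemma card_ord_ltn n p : (p <= n)%N -> #|[set k : 'I_n | (k < p)%N]| = p.
Proof.
move=> pn; rewrite -sum1_card (eq_bigl (fun k : 'I_n => (k < p)%N)).
  by rewrite (big_ord_narrow_cond (P := predT) pn) /= sum1_card card_ord.
by move=> k; rewrite inE.
Qed.

Lemma downset_card n (A : {set 'I_n}) (p : 'I_n) :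
  (forall i j : 'I_n, (i <= j)%N -> j \in A -> i \in A) ->
  (p \in A) = (p < #|A|)%N.
Proof.
move=> down; case: (boolP (p \in A)) => pA; apply/esym.
  rewrite -(card_ord_ltn (ltn_ord p)) subset_leq_card //.
  by apply/subsetP => k; rewrite inE ltnS => /down; apply.
apply/negbTE; rewrite -leqNgt -[X in (_ <= X)%N](card_ord_ltn (ltnW (ltn_ord p))).
apply: subset_leq_card; apply/subsetP => k kA; rewrite inE ltnNge.
by apply: contra pA => /down; apply.
Qed.

Section Cycles.
Variables (n : nat) (sg : 'S_n).

Lemma card_porbitP (i : 'I_n) r : (0 < r)%N ->
  #|porbit sg i| = r <->
  (iter r sg i = i /\ forall k, (0 < k < r)%N -> iter k sg i <> i).
Proof.
move=> r0; split=> [Er|[Er Hr]].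
  split=> [|k /andP[k0 kr]]; first by rewrite -Er iter_porbit.
  have := uniq_traject_porbit sg i; rewrite Er => U.
  move=> Ek; have := nth_uniq i _ _ U; move/(_ k 0%N); rewrite !size_traject kr r0.
  by rewrite !nth_traject //= Ek eqxx gtn_eqF // => /(_ isT isT).
have q0 : (0 < #|porbit sg i|)%N by apply/card_gt0P; exists i; exact: porbit_id.
have Eq := iter_porbit sg i.
case: (ltngtP #|porbit sg i| r) => // lt.
  by case: (Hr _ (introT andP (conj q0 lt)) Eq).
have := uniq_traject_porbit sg i => U.
have := nth_uniq i _ _ U; move/(_ r 0%N); rewrite !size_traject lt q0.
by rewrite !nth_traject //= Er eqxx gtn_eqF // => /(_ isT isT).
Qed.

Lemma cycle_type_nseqP r m : n = (r * m)%N -> (0 < r)%N ->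
  reflect (forall i, #|porbit sg i| = r) (cycle_type sg == nseq m r).
Proof.
move=> En r0; rewrite /cycle_type; apply: (iffP eqP) => [E i|H].
  have : #|porbit sg i| \in [seq #|c| | c : {set 'I_n} in porbits sg].
    by apply/imageP; exists (porbit sg i) => //; apply/imsetP; exists i.
  by rewrite -(mem_sort geq) E mem_nseq => /andP[_ /eqP].
set q := [seq _ | _ in _].
have Eq : q = nseq #|porbits sg| r.
  rewrite /q -[in RHS](size_image (fun c : {set 'I_n} => #|c|) (mem (porbits sg))).
  apply/all_pred1P/allP => x /imageP[c /imsetP[i _ ->] ->]; rewrite /= H //.
have Em : #|porbits sg| = m.
  apply/eqP; rewrite -(eqn_pmul2r r0) [X in _ == X]mulnC -En.
  rewrite -[X in _ == X]card_ord -[X in _ == X]sum1_card.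
  rewrite (partition_big_imset (porbit sg)) /= -/(porbits sg) -sum_nat_const.
  apply/eqP/eq_bigr => c /imsetP[j _ ->]; rewrite -(H j) -sum1_card.
  by apply: eq_bigl => i; rewrite eq_porbit_mem.
rewrite Eq Em -{2}[m](size_nseq m r) -(size_sort geq); apply/all_pred1P.
by rewrite all_sort; exact: all_pred1_nseq.
Qed.
End Cycles.

(** * Compatible pairs as sorted lists of positions *)

Section Std.
Variables (N n : nat).
Implicit Types (sg : 'S_n) (f : {ffun 'I_n -> 'I_N}).

Definition compat sg f := [forall i : 'I_n, forall i' : 'I_n, (i' == i.+1 :> nat) ==>
   (if i \in Dex sg then (f i' < f i)%N else (f i' <= f i)%N)].

(* The letter at position i: its value is f i and it is red at the excedances. *)
Definition letter_of sg f (i : 'I_n) : letter N := (rev_ord (f i), (sg i <= i)%N).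

Definition std sg f (i i' : 'I_n) : bool :=
  (letter_code (letter_of sg f i) < letter_code (letter_of sg f i'))%N
  || (letter_code (letter_of sg f i) == letter_code (letter_of sg f i')) && (sg i < sg i')%N.

(** For adjacent positions, the inequality demanded by [Dex] says exactly that (letter, image)
    increases lexicographically; transitivity extends this to all pairs. So positions are sorted by
    letter, ties being broken by the image. *)
Lemma compat_std sg f :
  compat sg f = [forall i : 'I_n, forall i' : 'I_n, (i < i')%N ==> std sg f i i'].
Proof.
have adj (i i' : 'I_n) : i' = i.+1 :> nat ->
    (if i \in Dex sg then (f i' < f i)%N else (f i' <= f i)%N) = std sg f i i'.
  move=> Ei.
  have -> : (i \in Dex sg) = (wletter sg i' < wletter sg i)%N.
    rewrite inE; apply/existsP/idP => [[j /andP[/eqP Ej]]|lt].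
      by have -> : j = i' by apply: val_inj; rewrite /= Ej Ei.
    by exists i'; rewrite Ei eqxx.
  have sgD : sg i <> sg i' :> nat.
    by move=> /val_inj/perm_inj E; move: Ei; rewrite E; lia.
  rewrite /wletter /std /letter_code /letter_of /=; have := ltn_ord (sg i); have := ltn_ord (sg i').
  have := ltn_ord (f i); have := ltn_ord (f i').
  case: (ltnP i (sg i)) => lt; case: (ltnP i' (sg i')) => lt' *;
    case: ifP => C; apply/idP/idP; lia.
have trans (i j k : 'I_n) : std sg f i j -> std sg f j k -> std sg f i k.
  by rewrite /std; lia.
apply/'forall_forallP/'forall_forallP => H i i'; apply/implyP.
  move=> lt; have [k Ek] : exists k, i' = (i + k.+1)%N :> nat.
    by exists (i' - i.+1)%N; lia.
  elim: k i' {lt} Ek => [|k IHk] i' Ei'.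
    rewrite -adj; last by lia.
    by apply: (implyP (H i i')); apply/eqP; lia.
  have lt : (i + k.+1 < n)%N by have := ltn_ord i'; lia.
  apply: (trans _ (Ordinal lt)); first exact: IHk.
  rewrite -adj /=; last by lia.
  by apply: (implyP (H _ i')); apply/eqP => /=; lia.
by move=> /eqP Ei; rewrite (adj _ _ Ei); apply: (implyP (H i i')); lia.
Qed.

End Std.

Definition orbit_word N n s (sg : 'S_n) (f : {ffun 'I_n -> 'I_N}) (i : 'I_n) : word N s :=
  [ffun k : 'I_s.+1 => letter_of sg f (iter k sg i)].
Arguments orbit_word {N n} s sg f i.

Section StandardPair.
Variables (N n s : nat) (sg : 'S_n) (f : {ffun 'I_n -> 'I_N}).
Hypothesis per : forall i, iter s.+1 sg i = i.
Hypothesis primH : forall i k, (0 < k < s.+1)%N -> iter k sg i <> i.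
Hypothesis stdH : forall i i' : 'I_n, (i < i')%N -> std sg f i i'.

Let W := orbit_word s sg f.

Lemma letter_at_orbit_word i k : letter_at (W i) k = letter_of sg f (iter k sg i).
Proof.
rewrite /letter_at ffunE inordK ?ltn_mod // [in RHS](divn_eq k s.+1) addnC iterD.
congr (letter_of _ _ (iter _ _ _)); elim: (k %/ s.+1)%N => // q IHq.
by rewrite mulSn iterD -IHq per.
Qed.

Lemma orbit_word_sg i : W (sg i) = rotw (W i).
Proof. by apply: word_eq => k _; rewrite letter_at_rotw !letter_at_orbit_word iterSr. Qed.

Lemma orbit_word_iter i k : W (iter k sg i) = iter k rotw (W i).
Proof. by elim: k => //= k IHk; rewrite orbit_word_sg IHk. Qed.

(** Positions with the same letter are ordered as their images, whose letters come next in the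
    words; iterating, positions are sorted by their words. *)
Lemma code_mono (i i' : 'I_n) : (i <= i')%N -> (code (W i) <= code (W i'))%N.
Proof.
have mono q (j j' : 'I_n) : (j < j')%N -> (prefix_code q (fun k => letter_of sg f (iter k sg j)) <=
    prefix_code q (fun k => letter_of sg f (iter k sg j')))%N.
  elim: q j j' => // q IHq j j' /stdH /orP[lt|/andP[/eqP E lt]].
    exact/ltnW/prefix_code_lt.
  rewrite /= E leq_add2l; have := IHq _ _ lt.
  by under eq_prefix_code do rewrite -iterSr; under [X in (_ <= X)%N]eq_prefix_code do rewrite -iterSr.
rewrite leq_eqVlt => /orP[/eqP/val_inj->//|/(mono s.+1)].
rewrite /code; under eq_prefix_code do rewrite -letter_at_orbit_word.
by under [X in (_ <= X)%N]eq_prefix_code do rewrite -letter_at_orbit_word.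
Qed.

Lemma orbit_word_tie (i i' : 'I_n) : W i = W i' -> (i < i')%N -> (sg i < sg i')%N.
Proof.
move=> E /stdH; rewrite /std; have -> : letter_of sg f i = letter_of sg f i'.
  by rewrite -(letter_at_orbit_word i 0) -(letter_at_orbit_word i' 0) E.
by rewrite ltnn eqxx.
Qed.

Lemma orbit_word_good i : good (W i).
Proof.
apply/andP; split.
  apply/allowedwP => k; rewrite !letter_at_orbit_word iterS; move: (iter k sg i) => j.
  rewrite allowed_letter_code /=; case: leqP => [|lt].
    rewrite leq_eqVlt => /orP[/eqP/val_inj->//|/stdH]; rewrite /std; lia.
  by have := stdH lt; rewrite /std; lia.
apply/primP => k ks; rewrite -orbit_word_iter => Ek.
(* If k is a period of the word of i, then [tau] preserves the order of the positions carrying that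
   word. An order preserving map either fixes i or moves it further in one direction for ever; as
   [tau] has finite order it fixes i, against the length of the cycle. *)
pose tau j := iter k sg j.
have tie (j j' : 'I_n) : W j = W j' -> (j < j')%N -> (tau j < tau j')%N.
  rewrite /tau; elim: k {ks Ek tau} j j' => // k IHk j j' E lt.
  by rewrite !iterSr IHk ?orbit_word_sg ?E // orbit_word_tie.
have Wt q : W (iter q tau i) = W i.
  elim: q => // q IHq; rewrite -[RHS]Ek; rewrite iterS /tau !orbit_word_iter.
  by congr (iter _ _ _); rewrite IHq.
have tper : iter s.+1 tau i = i.
  rewrite /tau; have -> : iter s.+1 (fun j => iter k sg j) i = iter (s.+1 * k) sg i.
    by elim: s.+1 => // q IHq; rewrite mulSn iterD -IHq.
  by rewrite mulnC; elim: k {ks Ek tau tie Wt} => // k IHk; rewrite mulSn iterD IHk.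
case: (ltngtP i (tau i)) => [lt|lt|/val_inj/esym]; last exact: primH.
- have step q : (iter q tau i < iter q.+1 tau i)%N.
    by elim: q => // q IHq; rewrite !iterS; apply: tie => //; rewrite -iterS !Wt.
  have : (i < iter s.+1 tau i)%N.
    by elim: s => // q IHq; apply: ltn_trans IHq (step _).
  by rewrite tper ltnn.
- have step q : (iter q.+1 tau i < iter q tau i)%N.
    by elim: q => // q IHq; rewrite !iterS; apply: tie => //; rewrite -iterS !Wt.
  have : (iter s.+1 tau i < i)%N.
    by elim: s => // q IHq; apply: ltn_trans (step _) IHq.
  by rewrite tper ltnn.
Qed.

(** This counts the k with [sg k < sg i]: those whose rotated word is smaller, and those with the
    word of i that precede i, since [sg] keeps the order among equal words. Hence the words alone
    determine [sg], which gives injectivity. *)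
Lemma sg_pos i : sg i = (#|[set k | code (W k) < code (rotw (W i))]|
   + #|[set k : 'I_n | (k < i) && (W k == W i)]|)%N :> nat.
Proof.
rewrite -[LHS](card_ord_ltn (ltnW (ltn_ord (sg i)))).
rewrite -(card_preimset _ (@perm_inj _ sg)) -[X in (X + _)%N](card_preimset _ (@perm_inj _ sg)).
set A := _ @^-1: [set k | (code _ < _)%N]; set B := [set k : 'I_n | _ && _].
have AB0 : A :&: B = set0.
  apply/setP => k; rewrite !inE orbit_word_sg.
  by apply/negbTE/negP => /andP[lt /andP[_ /eqP E]]; rewrite E ltnn in lt.
rewrite -[RHS]cardsUI AB0 cards0 addn0.
apply/eq_card => k; rewrite !inE -orbit_word_sg.
apply/idP/orP => [lt|[lt|/andP[lt /eqP E]]].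
- have := code_mono (ltnW lt); rewrite leq_eqVlt => /orP[/eqP E|]; last by left.
  right; have {}E : W k = W i by apply: rotw_inj; apply: code_inj; rewrite -!orbit_word_sg E.
  rewrite E eqxx andbT ltnNge leq_eqVlt negb_or; apply/andP; split.
    by apply: contraTneq lt => /val_inj->; rewrite ltnn.
  by apply/negP => /(orbit_word_tie (esym E)); lia.
- by rewrite ltnNge; apply/negP => /code_mono; rewrite leqNgt lt.
- exact: orbit_word_tie.
Qed.

End StandardPair.

Lemma mono_code_card N s n (W : 'I_n -> word N s) (p : 'I_n) K :
  (forall i i' : 'I_n, (i <= i')%N -> (code (W i) <= code (W i'))%N) ->
  (code (W p) < K)%N = (p < #|[set k | code (W k) < K]|)%N.
Proof.
move=> mono; rewrite -downset_card ?inE // => i j ij; rewrite !inE.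
exact/leq_ltn_trans/mono.
Qed.

Lemma mono_words_eq N s n (W W' : 'I_n -> word N s) :
  (forall i i' : 'I_n, (i <= i')%N -> (code (W i) <= code (W i'))%N) ->
  (forall i i' : 'I_n, (i <= i')%N -> (code (W' i) <= code (W' i'))%N) ->
  (forall w, #|[set i | W i == w]| = #|[set i | W' i == w]|) -> W =1 W'.
Proof.
move=> mono mono' E p; apply: code_inj.
have cardE (V : 'I_n -> word N s) K : #|[set k | code (V k) < K]|%N =
    (\sum_(w | (code w < K)%N) #|[set i | V i == w]|)%N.
  rewrite -sum1_card (partition_big V (fun w => (code w < K)%N)) /=; last first.
    by move=> i; rewrite inE.
  apply: eq_bigr => w wK; rewrite -sum1_card; apply: eq_bigl => i; rewrite !inE.
  by case: eqP => [->|_]; rewrite ?wK ?andbF.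
have lt K : (code (W p) < K)%N = (code (W' p) < K)%N.
  by rewrite !mono_code_card // !cardE; congr (_ < _)%N; apply: eq_bigr => w _; rewrite E.
by apply/eqP; rewrite eqn_leq -ltnS lt ltnSn -ltnS -lt ltnSn.
Qed.

(** * Standard pairs and multisets of necklaces *)

(* Rotation invariant multisets of s.+1 * m primitive allowed words: each
   necklace contributes its s.+1 rotations, so these are the multisets of m
   necklaces of length s.+1. *)
Definition wmultisets N s B m : {set {ffun word N s -> 'I_B.+1}} :=
  [set mu : {ffun word N s -> 'I_B.+1} | [&& (\sum_w mu w == s.+1 * m)%N, [forall w, mu (rotw w) == mu w]
     & [forall w, (mu w != 0%N :> nat) ==> good w]]].

Definition stdpairs N s n m : {set 'S_n * {ffun 'I_n -> 'I_N}} :=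
  [set p | (cycle_type p.1 == nseq m s.+1) && compat p.1 p.2].

Definition wmult N s n (p : 'S_n * {ffun 'I_n -> 'I_N}) :
    {ffun word N s -> 'I_n.+1} :=
  [ffun w => inord #|[set i | orbit_word s p.1 p.2 i == w]|].
Arguments wmult {N} s {n} p.

Lemma stdpairsP N s n m (p : 'S_n * {ffun 'I_n -> 'I_N}) : n = (s.+1 * m)%N ->
  reflect [/\ forall i, iter s.+1 p.1 i = i,
   forall i k, (0 < k < s.+1)%N -> iter k p.1 i <> i
   & forall i i' : 'I_n, (i < i')%N -> std p.1 p.2 i i'] (p \in stdpairs N s n m).
Proof.
move=> En; rewrite inE; apply: (iffP andP) => [[/(cycle_type_nseqP _ En (ltn0Sn s)) H1]|[P1 P2 P3]].
  rewrite compat_std => /'forall_forallP H2.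
  split=> [i|i k|i i']; last exact: (implyP (H2 i i')).
  - by have [] := (card_porbitP p.1 i (ltn0Sn s)).1 (H1 i).
  - by have [_] := (card_porbitP p.1 i (ltn0Sn s)).1 (H1 i); apply.
split; last by rewrite compat_std; apply/'forall_forallP => i i'; apply/implyP/P3.
by apply/(cycle_type_nseqP _ En (ltn0Sn s)) => i; apply/card_porbitP => //; split=> [|k]; [exact: P1|exact: P2].
Qed.

Lemma wmultE N s n (p : 'S_n * {ffun 'I_n -> 'I_N}) w :
  wmult s p w = #|[set i | orbit_word s p.1 p.2 i == w]| :> nat.
Proof. by rewrite ffunE inordK // ltnS -[X in (_ <= X)%N](card_ord n) max_card. Qed.

Lemma wmult_inj N s n m : n = (s.+1 * m)%N ->
  {in stdpairs N s n m &, injective (@wmult N s n)}.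
Proof.
move=> En p p' /(stdpairsP _ En)[H1 H2 H3] /(stdpairsP _ En)[H1' H2' H3'] E.
have EW : orbit_word s p.1 p.2 =1 orbit_word s p'.1 p'.2.
  apply: mono_words_eq => [i i'|i i'|w]; try exact: code_mono.
  by rewrite -!wmultE E.
have Ec i : letter_of p.1 p.2 i = letter_of p'.1 p'.2 i.
  by rewrite -(letter_at_orbit_word p.2 H1 i 0) -(letter_at_orbit_word p'.2 H1' i 0) EW.
case: p p' E H1 H2 H3 H1' H2' H3' EW Ec => [sg f] [sg' f'] /= _ H1 H2 H3 H1' H2' H3' EW Ec.
congr pair.
  apply/permP => i; apply: val_inj; rewrite /= (sg_pos H1 H3) (sg_pos H1' H3').
  rewrite EW; congr (_ + _)%N; apply: eq_card => k; rewrite !inE EW //.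
by apply/ffunP => i; have /(congr1 fst)/rev_ord_inj := Ec i.
Qed.

Lemma wmult_in N s n m p : n = (s.+1 * m)%N ->
  p \in stdpairs N s n m -> wmult s p \in wmultisets N s n m.
Proof.
move=> En /(stdpairsP _ En)[H1 H2 H3]; rewrite inE; apply/and3P; split.
- rewrite -En (eq_bigr (fun w => #|[set i | orbit_word s p.1 p.2 i == w]|)); last first.
    by move=> w _; rewrite wmultE.
  rewrite -[X in _ == X]card_ord -sum1_card.
  rewrite (partition_big (orbit_word s p.1 p.2) predT) //=; apply/eqP/eq_bigr => w _.
  by rewrite -sum1_card; apply: eq_bigl => i; rewrite inE.
- apply/forallP => w; apply/eqP/val_inj; rewrite /= !wmultE.
  rewrite -(card_preimset _ (@perm_inj _ p.1)); apply: eq_card => i.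
  by rewrite !inE orbit_word_sg // (inj_eq (@rotw_inj N s)).
- apply/forallP => w; apply/implyP; rewrite wmultE cards_eq0 => /set0Pn[i].
  by rewrite inE => /eqP<-; exact: orbit_word_good.
Qed.

Lemma exists_mono_words N s n (mu : {ffun word N s -> 'I_n.+1}) :
  (\sum_w mu w = n)%N -> exists W : 'I_n -> word N s,
  (forall w, #|[set i | W i == w]| = mu w) /\
  (forall i i' : 'I_n, (i <= i')%N -> (code (W i) <= code (W i'))%N).
Proof.
move=> tot; pose le (u v : word N s) := (code u <= code v)%N.
pose q := flatten [seq nseq (mu w) w | w <- enum {: word N s}].
have sz : size (sort le q) == n.
  rewrite size_sort size_flatten /shape -map_comp sumnE big_map big_enum /=.
  by rewrite -[X in _ == X]tot; apply/eqP/eq_bigr => w _; rewrite /= size_nseq.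
pose t := Tuple sz; exists (tnth t); split=> [w|i i' ii'].
  have -> : mu w = count_mem w t :> nat.
    rewrite /= count_sort count_flatten -map_comp sumnE big_map big_enum /=.
    rewrite (bigD1 w) //= count_nseq /= eqxx mul1n big1 ?addn0 // => v vw.
    by rewrite /= count_nseq /= (negbTE vw).
  rewrite -sum1_count big_tuple -sum1_card; apply: eq_bigl => i.
  by rewrite inE.
have srt : sorted le t by apply: sort_sorted => u v; exact: leq_total.
pose x0 := tnth t i; rewrite -/(le _ _) (tnth_nth x0 t i) (tnth_nth x0 t i').
apply: (sorted_leq_nth _ _ x0 srt) => //; rewrite ?inE ?size_tuple ?ltn_ord //.
- by move=> u v w; apply: leq_trans.
- by move=> u; exact: leqnn.
Qed.

Lemma prefix_code_rcons N n (g : nat -> letter N) :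
  prefix_code n.+1 g = (prefix_code n g * N.*2 + letter_code (g n))%N.
Proof.
elim: n g => [|n IHn] g; first by rewrite /= muln1 addn0.
have cdS q (h : nat -> letter N) : prefix_code q.+1 h = (letter_code (h 0) * N.*2 ^ q + prefix_code q (fun k => h k.+1))%N by [].
by rewrite [LHS]cdS IHn (cdS n g) mulnDl -mulnA -expnSr addnA.
Qed.

(** The inverse construction: the words of the multiset, listed in increasing order, are the
    positions, and [sg] sends a position to the copy of the rotated word that has the same rank
    among its equal copies. Rotation invariance of [mu] provides equally many copies. *)
Lemma wmult_surj N s n m mu : n = (s.+1 * m)%N -> (0 < s)%N ->
  mu \in wmultisets N s n m -> exists2 p, p \in stdpairs N s n m & mu = wmult s p.
Proof.
move=> En s_gt0; rewrite inE => /and3P[/eqP tot /forallP inv /forallP gd].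
rewrite -En in tot; have [W [cW mono]] := exists_mono_words tot.
pose rank (i : 'I_n) := #|[set k : 'I_n | (k < i)%N && (W k == W i)]|.
pose lo (v : word N s) := #|[set k | (code (W k) < code v)%N]|.
have W_lt (i j : 'I_n) : (code (W i) < code (W j))%N -> (i < j)%N.
  by rewrite !ltnNge; apply: contra; exact: mono.
have posE (i : 'I_n) : i = (lo (W i) + rank i)%N :> nat.
  rewrite -[LHS](card_ord_ltn (ltnW (ltn_ord i))) /lo /rank.
  set A := [set k | (code _ < _)%N]; set B := [set k : 'I_n | _ && _].
  have AB0 : A :&: B = set0.
    apply/setP => k; rewrite !inE.
    by apply/negbTE/negP => /andP[lt /andP[_ /eqP E]]; rewrite E ltnn in lt.
  rewrite -[RHS]cardsUI AB0 cards0 addn0; apply: eq_card => k; rewrite !inE.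
  apply/idP/orP => [lt|[/W_lt//|/andP[]//]].
  have := mono _ _ (ltnW lt); rewrite leq_eqVlt => /orP[/eqP/code_inj E|]; last by left.
  by right; rewrite lt E eqxx.
have W_good i : good (W i).
  apply: (implyP (gd _)); rewrite -cW cards_eq0; apply/set0Pn; exists i.
  by rewrite inE.
(* The copies of v occupy the positions from [lo v] up to, but excluding, [lo v + mu v]. *)
have hi v : (lo v + mu v)%N = #|[set k | (code (W k) < (code v).+1)%N]|.
  rewrite -cW -cardsUI [X in (_ + X)%N](_ : _ = 0%N) ?addn0; last first.
    apply/eqP; rewrite cards_eq0; apply/eqP/setP => k; rewrite !inE.
    by apply/negbTE/negP => /andP[lt /eqP E]; rewrite E ltnn in lt.
  apply: eq_card => k; rewrite !inE ltnS [in RHS]leq_eqVlt orbC.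
  by rewrite (inj_eq (@code_inj N s)).
have rank_lt i : (rank i < mu (W i))%N.
  rewrite -cW; apply: proper_card; apply/properP; split.
    by apply/subsetP => k; rewrite !inE => /andP[].
  by exists i; rewrite !inE ?eqxx // ltnn.
have inv_nat w : mu (rotw w) = mu w by apply/eqP.
have sgn_lt i : (lo (rotw (W i)) + rank i < n)%N.
  apply: (@leq_trans (lo (rotw (W i)) + mu (rotw (W i)))); last first.
    by rewrite hi -[X in (_ <= X)%N](card_ord n) max_card.
  by rewrite ltn_add2l inv_nat rank_lt.
pose sgf i := Ordinal (sgn_lt i).
have W_sgf i : W (sgf i) = rotw (W i).
  apply: code_inj; apply/eqP; rewrite eqn_leq -ltnS mono_code_card // -hi.
  rewrite inv_nat ltn_add2l rank_lt /= leqNgt mono_code_card //.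
  by rewrite -leqNgt leq_addr.
have rank_sgf i : rank (sgf i) = rank i.
  by have := posE (sgf i); rewrite W_sgf /= => /addnI.
have sgf_inj : injective sgf.
  move=> i j E; have EW : W i = W j by apply: rotw_inj; rewrite -!W_sgf E.
  by apply: val_inj; rewrite /= posE [RHS]posE EW -rank_sgf E rank_sgf.
pose sg := perm sgf_inj; have sgE i : sg i = sgf i by rewrite permE.
(* Primitivity and s > 0 make a word differ from its rotation, so the weak inequality of
   [prefix_code_allowed] is strict and the colour tells whether i is an excedance. *)
have colE i : (letter_at (W i) 0).2 = (sg i <= i)%N.
  have /andP[/allowedwP al /primP pr] := W_good i.
  have := prefix_code_allowed s.+1 al; rewrite -code_rotw -/(code _) sgE.
  have ne : code (rotw (W i)) != code (W i).
    by apply/eqP => /code_inj; apply: (pr 1%N).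
  case: (letter_at (W i) 0).2 => le.
    have lt : (code (W (sgf i)) < code (W i))%N by rewrite W_sgf ltn_neqAle ne le.
    by rewrite ltnW // W_lt.
  have lt : (code (W i) < code (W (sgf i)))%N by rewrite W_sgf ltn_neqAle eq_sym ne le.
  by rewrite leqNgt W_lt.
pose f := [ffun i => rev_ord (letter_at (W i) 0).1].
have lcolE i : letter_of sg f i = letter_at (W i) 0.
  by rewrite /letter_of ffunE rev_ordK -colE -surjective_pairing.
have W_iter k i : W (iter k sg i) = iter k rotw (W i).
  by elim: k => //= k IHk; rewrite sgE W_sgf IHk.
have rank_iter k i : rank (iter k sg i) = rank i.
  by elim: k => //= k IHk; rewrite sgE rank_sgf IHk.
have per i : iter s.+1 sg i = i.
  have := posE (iter s.+1 sg i); rewrite W_iter iter_rotw_size rank_iter -posE.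
  exact: val_inj.
have stdp : (sg, f) \in stdpairs N s n m.
  apply/(stdpairsP _ En); split => //= [i k ks /(congr1 W)|i i' lt].
    by rewrite W_iter; have /andP[_ /primP] := W_good i; apply.
  rewrite /std !lcolE.
  have : (letter_code (letter_at (W i) 0) <= letter_code (letter_at (W i') 0))%N.
    rewrite leqNgt; apply/negP => /(@prefix_code_lt _ s); rewrite ltnNge.
    by rewrite (mono _ _ (ltnW lt)).
  rewrite leq_eqVlt => /orP[/eqP E|->//]; rewrite E ltnn eqxx /=.
  (* Rotation moves the common first letter to the end of both words, so the rotated words compare
     as the words do. *)
  have : (code (rotw (W i)) <= code (rotw (W i')))%N.
    have := mono _ _ (ltnW lt); rewrite !code_rotw !prefix_code_rcons /code /= E leq_add2l.
    by rewrite /letter_at !modnn -!/(letter_at _ 0) E leq_add2r => /leq_mul -> .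
  rewrite leq_eqVlt => /orP[/eqP/code_inj E1|]; last by rewrite -!W_sgf -!sgE => /W_lt.
  rewrite !sgE /= E1 ltn_add2l.
  by move: lt; rewrite posE [X in (_ < X)%N]posE (rotw_inj E1) ltn_add2l.
exists (sg, f) => //; apply/ffunP => w; apply: val_inj; rewrite /= wmultE -cW.
apply: eq_card => i; rewrite !inE; congr (_ == _); apply: word_eq => k _.
by rewrite letter_at_orbit_word //= lcolE W_iter letter_at_iter.
Qed.

Lemma wmult_imset N s n m : n = (s.+1 * m)%N -> (0 < s)%N ->
  [set wmult s p | p in stdpairs N s n m] = wmultisets N s n m.
Proof.
move=> En s_gt0; apply/setP => mu; apply/imsetP/idP => [[p pS ->]|/wmult_surj].
  exact: wmult_in.
by move=> /(_ En s_gt0)[p pS ->]; exists p.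
Qed.

Section Weights.
Variables (K : comRingType) (N s : nat) (wt : letter N -> K).

(** First letters suffice: the multiset contains all rotations of each word, and their first letters
    spell the word. *)
Definition multiset_weight B (mu : {ffun word N s -> 'I_B.+1}) : K :=
  \prod_w wt (letter_at w 0) ^+ mu w.

Lemma sum_stdpairs n m : n = (s.+1 * m)%N -> (0 < s)%N ->
  \sum_(p in stdpairs N s n m) \prod_i wt (letter_of p.1 p.2 i) =
  \sum_(mu in wmultisets N s n m) multiset_weight mu.
Proof.
move=> En s_gt0; rewrite -wmult_imset // big_imset /=; last exact: wmult_inj En.
apply: eq_bigr => p /(stdpairsP _ En)[H1 H2 H3].
rewrite (partition_big (orbit_word s p.1 p.2) predT) //=; apply: eq_bigr => w _.
rewrite (eq_bigr (fun=> wt (letter_at w 0))); last first.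
  by move=> i /eqP <-; rewrite letter_at_orbit_word.
by rewrite prodr_const wmultE; congr (_ ^+ _); apply: eq_card => i; rewrite !inE.
Qed.
End Weights.

(** * Newton recursion for multisets of necklaces *)

Section Orbit.
Variables N s : nat.
Implicit Types w v : word N s.

Definition worb w : {set word N s} := [set iter k rotw w | k : 'I_s.+1].

Lemma worb_id w : w \in worb w.
Proof. by apply/imsetP; exists ord0. Qed.

Lemma worb_rotw w v : (rotw v \in worb w) = (v \in worb w).
Proof.
apply/imsetP/imsetP => [[[[|k] ks] _ /= E]|[[k ks] _ /= ->]].
- exists ord_max => //; apply: rotw_inj; rewrite E /= -iterS iter_rotw_size //.
- exists (Ordinal (ltnW ks)) => //; exact: rotw_inj.
- have [lt|] := ltnP k.+1 s.+1; first by exists (Ordinal lt).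
  move=> le; exists ord0 => //=; rewrite -iterS (_ : k.+1 = s.+1) ?iter_rotw_size //.
  by apply/eqP; rewrite eqn_leq ks.
Qed.

Lemma iter_rotw_prim_inj w : prim w ->
  injective (fun k : 'I_s.+1 => iter k rotw w).
Proof.
move/primP => pr.
suff H (j k : 'I_s.+1) : (j < k)%N -> iter j rotw w <> iter k rotw w.
  move=> j k E; apply: val_inj; case: (ltngtP j k) => // lt; first by case: (H _ _ lt E).
  by case: (H _ _ lt (esym E)).
move=> lt E; apply: (pr (k - j)%N); first by have := ltn_ord k; lia.
have itinj q : injective (iter q (@rotw N s)).
  by elim: q => // q IHq x y /= /rotw_inj/IHq.
by apply: (itinj j); rewrite -iterD subnKC ?(ltnW lt).
Qed.

Lemma card_worb w : prim w -> #|worb w| = s.+1.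
Proof.
by move=> /iter_rotw_prim_inj/card_imset ->; rewrite card_ord.
Qed.

Lemma good_rotw w : good w -> good (rotw w).
Proof.
move=> /andP[al /primP pr]; apply/andP; split; first exact: allowedw_rotw.
by apply/primP => k /pr H; rewrite -iterSr iterS => /rotw_inj.
Qed.

Lemma good_worb w v : good w -> v \in worb w -> good v.
Proof.
by move=> gw /imsetP[k _ ->]; elim: (k : nat) => //= q; exact: good_rotw.
Qed.

Lemma worb_const B (mu : {ffun word N s -> 'I_B.+1}) w v :
  (forall u, mu (rotw u) = mu u) -> v \in worb w -> mu v = mu w.
Proof. by move=> inv /imsetP[k _ ->]; elim: (k : nat) => //= q <-. Qed.

Definition wweight (K : comRingType) (wt : letter N -> K) w : K :=
  \prod_(k < s.+1) wt (letter_at w k).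

Lemma prod_worb (K : comRingType) (wt : letter N -> K) w : prim w ->
  \prod_(v in worb w) wt (letter_at v 0) = wweight wt w.
Proof.
move=> pr; rewrite big_imset /=; last by move=> j k _ _; exact: iter_rotw_prim_inj.
by apply: eq_bigr => k _; rewrite letter_at_iter.
Qed.

End Orbit.

Section Newton.
Variables (K : comRingType) (N s : nat) (wt : letter N -> K).
Local Notation word := (word N s).
Local Notation MS := (wmultisets N s).

Lemma wmultisetsP B m (mu : {ffun word -> 'I_B.+1}) :
  reflect [/\ (\sum_w mu w = s.+1 * m)%N, forall w, mu (rotw w) = mu w
    & forall w, (mu w != 0%N :> nat) -> good w] (mu \in MS B m).
Proof.
rewrite inE; apply: (iffP and3P) => -[/eqP H1 H2 H3]; split=> //.
- by move=> w; apply/eqP; apply: (forallP H2).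
- by move=> w; apply/implyP; apply: (forallP H3).
- by apply/forallP => w; apply/eqP.
- by apply/forallP => w; apply/implyP; apply: H3.
Qed.

(** Adds i copies of the necklace of [w], that is of each of its rotations. The truncation by
    [inord] is harmless while the multiplicities stay within B. *)
Definition madd B (w : word) i (mu : {ffun word -> 'I_B.+1}) : {ffun word -> 'I_B.+1} :=
  [ffun v => inord (mu v + i * (v \in worb w))].
Definition msub B (w : word) i (mu : {ffun word -> 'I_B.+1}) : {ffun word -> 'I_B.+1} :=
  [ffun v => inord (mu v - i * (v \in worb w))].

Lemma msubE B (w : word) i (mu : {ffun word -> 'I_B.+1}) v :
  msub w i mu v = (mu v - i * (v \in worb w))%N :> nat.
Proof. by rewrite ffunE inordK // (leq_ltn_trans (leq_subr _ _)). Qed.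

Lemma sum_worb i (w : word) : prim w -> (\sum_v i * (v \in worb w) = s.+1 * i)%N.
Proof.
move=> pr; rewrite -big_distrr /= mulnC; congr muln.
apply: etrans (card_worb pr); rewrite -sum1_card [RHS]big_mkcond.
by apply: eq_bigr => v _; case: (v \in _).
Qed.

(** Removing i copies of the necklace of [w] is a bijection, and the first letters of one copy
    multiply to [wweight wt w]. *)
Lemma sum_wmultisets_ge B m (w : word) i : (s.+1 * m <= B)%N -> (i <= m)%N -> good w ->
  \sum_(mu in MS B m | (i <= mu w)%N) multiset_weight wt mu =
  wweight wt w ^+ i * \sum_(mu in MS B (m - i)) multiset_weight wt mu.
Proof.
move=> mB im gw; have pr : prim w by have /andP[] := gw.
have maddE (mu : {ffun word -> 'I_B.+1}) v : mu \in MS B (m - i) ->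
    madd w i mu v = (mu v + i * (v \in worb w))%N :> nat.
  move=> /wmultisetsP[tot _ _]; rewrite ffunE inordK // ltnS (leq_trans _ mB) //.
  have -> : (s.+1 * m = \sum_v (mu v + i * (v \in worb w)))%N.
    by rewrite big_split /= tot sum_worb // -mulnDr subnK.
  by rewrite (bigD1 v) //= leq_addr.
have geP (mu : {ffun word -> 'I_B.+1}) v : mu \in MS B m -> (i <= mu w)%N -> (i * (v \in worb w) <= mu v)%N.
  move=> /wmultisetsP[_ inv _] le; case: (boolP (v \in _)) => [/(worb_const inv)->|_].
    by rewrite muln1.
  by rewrite muln0.
have msubK (mu : {ffun word -> 'I_B.+1}) : mu \in MS B m -> (i <= mu w)%N -> madd w i (msub w i mu) = mu.
  move=> muM le; apply/ffunP => v; apply: val_inj; rewrite /= ffunE msubE subnK ?geP //.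
  by rewrite inord_val.
rewrite (reindex_onto (madd w i) (msub w i)) /=; last first.
  by move=> mu /andP[muM le]; exact: msubK.
rewrite mulr_sumr; apply: eq_big => [mu|mu].
  apply/idP/idP => [/andP[/andP[muM le] /eqP <-]|muM].
    have /wmultisetsP[tot inv gd] := muM; apply/wmultisetsP; split=> [|v|v].
    - under eq_bigr do rewrite msubE.
      by rewrite sumnB ?tot ?sum_worb -?mulnBr // => v _; exact: geP.
    - by apply: val_inj; rewrite /= !msubE inv worb_rotw.
    - rewrite msubE => ne; apply: gd; move: ne; lia.
  have /wmultisetsP[tot inv gd] := muM.
  have -> : msub w i (madd w i mu) == mu.
    by apply/eqP/ffunP => v; apply: val_inj; rewrite /= msubE maddE // addnK.
  rewrite maddE // worb_id muln1 leq_addl !andbT; apply/wmultisetsP; split=> [|v|v].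
  - under eq_bigr do rewrite maddE //.
    by rewrite big_split /= tot sum_worb // -mulnDr subnK.
  - by apply: val_inj; rewrite /= !maddE // inv worb_rotw.
  - rewrite maddE //; case: (boolP (v \in _)) => [vw _|_]; first exact: good_worb gw vw.
    by rewrite muln0 addn0; exact: gd.
move=> /andP[/andP[muM le] /eqP E].
have muM' : mu \in MS B (m - i).
  rewrite -E; have /wmultisetsP[tot inv gd] := muM; apply/wmultisetsP; split=> [|v|v].
  - under eq_bigr do rewrite msubE.
    by rewrite sumnB ?tot ?sum_worb -?mulnBr // => v _; exact: geP.
  - by apply: val_inj; rewrite /= !msubE inv worb_rotw.
  - rewrite msubE => ne; apply: gd; move: ne; lia.
rewrite /multiset_weight -(prod_worb _ pr) -prodrXl [in RHS]big_mkcond -big_split /=.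
apply: eq_bigr => v _; rewrite maddE // exprD mulrC.
by case: (v \in _); rewrite ?muln1 ?muln0 ?expr0.
Qed.

Definition primsum i : K := \sum_(w : word | good w) wweight wt w ^+ i.

(** The factor s.+1 * m is the total multiplicity, so it counts the pairs of a word w and an index i
    < mu w. For a fixed pair, i + 1 copies of the necklace of w can be removed. *)
Lemma wmultisets_newton B m : (s.+1 * m <= B)%N ->
  (s.+1 * m)%:R * \sum_(mu in MS B m) multiset_weight wt mu =
  \sum_(i < m) primsum i.+1 * \sum_(mu in MS B (m - i.+1)) multiset_weight wt mu.
Proof.
move=> mB; have le_m (mu : {ffun word -> 'I_B.+1}) w : mu \in MS B m -> (mu w <= m)%N.
  move=> /wmultisetsP[tot inv gd]; have [->//|/gd gw] := eqVneq (mu w : nat) 0%N.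
  have pr : prim w by have /andP[] := gw.
  rewrite -(leq_pmul2l (ltn0Sn s)) -tot -(sum_worb _ pr); apply: leq_sum => v _.
  case: (boolP (v \in _)) => [/(worb_const inv)->|_]; by rewrite ?muln1 ?muln0.
rewrite mulr_sumr.
transitivity (\sum_(w : word) \sum_(i < m) \sum_(mu in MS B m | (i < mu w)%N) multiset_weight wt mu).
  under [RHS]eq_bigr do under eq_bigr do rewrite big_mkcondr /=.
  under [RHS]eq_bigr do rewrite exchange_big /=.
  rewrite exchange_big /=; apply: eq_bigr => mu muM.
  have /wmultisetsP[tot _ _] := muM; rewrite -tot natr_sum mulr_suml.
  apply: eq_bigr => w _; rewrite -big_mkcond /= sumr_const mulr_natl; congr (_ *+ _).
  rewrite -[LHS](card_ord_ltn (le_m _ w muM)); apply: eq_card => k; rewrite inE //.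
rewrite exchange_big /=; apply: eq_bigr => i _.
rewrite /primsum mulr_suml [RHS]big_mkcond /=; apply: eq_bigr => w _.
case: ifP => gw; first by rewrite sum_wmultisets_ge.
rewrite big_pred0 // => mu; apply/negP => /andP[/wmultisetsP[_ _ gd] lt].
by move: gw; rewrite gd // -lt0n (leq_ltn_trans _ lt).
Qed.

Lemma wmultisets0 B : \sum_(mu in MS B 0) multiset_weight wt mu = 1.
Proof.
rewrite (big_pred1 [ffun => ord0]) => [|mu /=].
  by rewrite /multiset_weight big1 // => w _; rewrite ffunE expr0.
apply/wmultisetsP/eqP => [[tot _ _]|->].
  apply/ffunP => w; apply: val_inj; rewrite ffunE /=; apply/eqP.
  by move: tot; rewrite muln0 => /eqP; rewrite sum_nat_eq0 => /forallP/(_ w).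
split=> [|w|w]; rewrite ?ffunE ?muln0 //.
by rewrite big1 // => w _; rewrite ffunE.
Qed.

End Newton.

(** * Primitive words and all words *)

Section Period.
Variables N s : nat.
Implicit Types w : word N s.

Lemma rotw_iter_eqP w j :
  reflect (forall k, letter_at w (k + j) = letter_at w k) (iter j rotw w == w).
Proof.
apply: (iffP eqP) => [E k|E]; first by rewrite -letter_at_iter E.
by apply: word_eq => k _; rewrite letter_at_iter.
Qed.

(* The minimal period is (minper w).+1. *)
Definition minper w : 'I_s.+1 := [arg min_(p < ord_max | iter p.+1 rotw w == w) p].

Lemma minperP w (p : 'I_s.+1) : reflect
  (iter p.+1 rotw w = w /\ forall j, (0 < j < p.+1)%N -> iter j rotw w <> w)
  (minper w == p).
Proof.
rewrite /minper; case: arg_minnP => [|q /eqP qP qmin]; first by rewrite iter_rotw_size.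
apply: (iffP eqP) => [<-|[pP pmin]].
  split=> // -[//|j] /andP[_ jq] E.
  have js : (j < s.+1)%N by rewrite (ltn_trans _ (ltn_ord q)).
  by have := qmin (Ordinal js) (introT eqP E); rewrite /= leqNgt -ltnS jq.
apply: val_inj; apply/eqP; rewrite eqn_leq qmin ?pP //= leqNgt; apply/negP => lt.
by case: (pmin q.+1).
Qed.

Lemma minper_dvd w : ((minper w).+1 %| s.+1)%N.
Proof.
set p := minper w; have /minperP[pP pmin] : minper w == p by [].
have it q : iter (q * p.+1) rotw w = w.
  by elim: q => // q IHq; rewrite mulSn iterD IHq.
have := iter_rotw_size w; rewrite {1}(divn_eq s.+1 p.+1) addnC iterD it => E.
rewrite /dvdn; apply/negPn/negP; rewrite -lt0n => gt0.
by apply: (pmin (s.+1 %% p.+1)%N) => //; rewrite gt0 ltn_mod.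
Qed.
End Period.

Lemma prod_periodic (K : comRingType) (F : nat -> K) P q :
  (forall k, F (k + P)%N = F k) -> \prod_(k < q * P) F k = (\prod_(k < P) F k) ^+ q.
Proof.
move=> per; have perq j k : F (k + j * P)%N = F k.
  by elim: j => [|j IHj]; rewrite ?addn0 // mulSnr addnA per.
elim: q => [|q IHq]; first by rewrite big_ord0.
rewrite exprSr -IHq mulSnr big_split_ord /=; congr (_ * _).
by apply: eq_bigr => k _; rewrite addnC perq.
Qed.

Definition wordsum (K : comRingType) N (wt : letter N -> K) s i : K :=
  \sum_(w : word N s | allowedw w) wweight wt w ^+ i.

Definition resize N s (p : nat) (w : word N s) : word N p :=
  [ffun k : 'I_p.+1 => letter_at w k].

Lemma letter_at_resize N s p (w : word N s) k :
  (forall j, letter_at w (j + p.+1) = letter_at w j) -> letter_at (resize p w) k = letter_at w k.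
Proof.
move=> per; have perq q j : letter_at w (j + q * p.+1) = letter_at w j.
  by elim: q => [|q IHq]; rewrite ?addn0 // mulSnr addnA per.
by rewrite {1}/letter_at ffunE inordK ?ltn_mod // [in RHS](divn_eq k p.+1) addnC perq.
Qed.

Lemma wordsum_primsum (K : comRingType) N (wt : letter N -> K) s i :
  wordsum wt s i = \sum_(p < s.+1 | (p.+1 %| s.+1)%N)
     primsum p wt (s.+1 %/ p.+1 * i).
Proof.
rewrite /wordsum (partition_big (@minper N s) (fun p => (p.+1 %| s.+1)%N)) /=; last first.
  by move=> w _; exact: minper_dvd.
apply: eq_bigr => p ps.
have perv (v : word N p) j : letter_at v (j + s.+1) = letter_at v j.
  by rewrite /letter_at -modnDmr (eqP ps) addn0.
have per_p (v : word N p) j : letter_at v (j + p.+1) = letter_at v j by rewrite /letter_at modnDr.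
have resK (w : word N s) : iter p.+1 rotw w = w -> resize s (resize p w) = w.
  move=> /eqP/rotw_iter_eqP per; apply: word_eq => k _.
  by rewrite !letter_at_resize // => j; rewrite !letter_at_resize // /letter_at modnDr.
rewrite (reindex_onto (resize s) (resize p)) /=; last first.
  by move=> w /andP[_ /minperP[pP _]]; exact: resK.
apply: eq_big => [v|v _].
  have -> : resize p (resize s v) == v.
    by apply/eqP/word_eq => k _; rewrite !letter_at_resize // => j; rewrite !letter_at_resize.
  rewrite andbT; congr andb.
    by apply/allowedwP/allowedwP => al k; have := al k; rewrite !letter_at_resize.
  have itE j : (iter j rotw (resize s v) == resize s v) = (iter j rotw v == v).
    by apply/rotw_iter_eqP/rotw_iter_eqP => E k; have := E k; rewrite !letter_at_resize.
  apply/minperP/primP => [[_ pmin] k kp /eqP E|pr]; last split.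
  - by apply: (pmin k kp); apply/eqP; rewrite itE.
  - by apply/eqP; rewrite itE iter_rotw_size.
  - by move=> j jp /eqP; rewrite itE => /eqP; exact: pr.
rewrite exprM /wweight; congr (_ ^+ _).
under eq_bigr do rewrite letter_at_resize //.
rewrite -(@prod_periodic _ (fun k => wt (letter_at v k)) p.+1) ?divnK // => k.
by rewrite per_p.
Qed.

(** * Cyclic words as traces of a transfer matrix *)

Section ClosedWalks.
Variables (K : comRingType) (L : finType) (A : L -> L -> K).

(** Walks from a to b with n intermediate vertices, hence n + 1 steps. *)
Fixpoint walksum n a b : K :=
  if n is n'.+1 then \sum_x A a x * walksum n' x b else A a b.

Fixpoint chain a q b : K :=
  if q is x :: q' then A a x * chain x q' b else A a b.

Lemma chainE a q b : chain a q b =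
  \prod_(k < (size q).+1) A (nth a (a :: q) k) (nth a (rcons q b) k).
Proof.
suff H x0 : chain a q b =
    \prod_(k < (size q).+1) A (nth x0 (a :: q) k) (nth x0 (rcons q b) k) by exact: H.
elim: q a => [|x q IHq] a; first by rewrite /= big_ord_recl big_ord0 mulr1.
by rewrite big_ord_recl /= IHq.
Qed.

Lemma sum_tupleS (R : nmodType) n (F : seq L -> R) :
  \sum_(q : n.+1.-tuple L) F q = \sum_x \sum_(q : n.-tuple L) F (x :: q).
Proof.
rewrite pair_big /= (reindex (fun p : L * n.-tuple L => [tuple of p.1 :: p.2])) /=.
  by apply: eq_bigr.
exists (fun q : n.+1.-tuple L => (thead q, [tuple of behead q])) => [[x q]|q] _ /=.
  by congr pair; apply: val_inj.
by rewrite -tuple_eta.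
Qed.

Lemma sum_chain n a b : \sum_(q : n.-tuple L) chain a q b = walksum n a b.
Proof.
elim: n a => [|n IHn] a.
  by rewrite (big_pred1 [tuple]) // => q; apply/esym/eqP; exact: tuple0.
rewrite (sum_tupleS n (fun q => chain a q b)) /=; apply: eq_bigr => x _.
by rewrite -mulr_sumr IHn.
Qed.

Lemma sum_closed_walks s :
  \sum_(w : {ffun 'I_s.+1 -> L}) \prod_(k < s.+1) A (w k) (w (ordS k)) =
  \sum_a walksum s a a.
Proof.
under [RHS]eq_bigr do rewrite -sum_chain.
rewrite pair_big /=.
pose h (p : L * s.-tuple L) : {ffun 'I_s.+1 -> L} := [ffun k : 'I_s.+1 => nth p.1 (p.1 :: p.2) k].
rewrite (reindex h) /=; last first.
  exists (fun w => (w ord0, [tuple w (lift ord0 k) | k < s])) => [[a q]|w] _ /=.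
    rewrite /h /= ffunE /=; congr pair; apply: eq_from_tnth => k.
    by rewrite tnth_mktuple ffunE /= (tnth_nth a).
  apply/ffunP => k; rewrite ffunE; case: (unliftP ord0 k) => [j ->|->] //.
  by rewrite lift0 -[RHS](tnth_mktuple (fun j => w (lift ord0 j))) (tnth_nth (w ord0)).
apply: eq_bigr => -[a q] _; rewrite chainE size_tuple; apply: eq_bigr => k _.
rewrite !ffunE /=; congr A; rewrite nth_rcons size_tuple.
have [lt|ge] := ltnP k s; first by rewrite modn_small.
have -> : k = s :> nat by apply/eqP; rewrite eqn_leq ge -ltnS ltn_ord.
by rewrite modnn eqxx.
Qed.

End ClosedWalks.

Lemma sum_prod_type (R : nmodType) (I J : finType) (F : I * J -> R) :
  \sum_p F p = \sum_i \sum_j F (i, j).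
Proof. by rewrite pair_big /=; apply: eq_bigr; case. Qed.

Definition letter_weight (K : comRingType) N (y : 'I_N -> K) (t : K) (a : letter N) : K :=
  y a.1 * (if a.2 then 1 else t).

Definition transfer (K : comRingType) N (y : 'I_N -> K) (t : K) : 'M[K]_N :=
  \matrix_(a, a') (y a * (t * (a <= a')%N%:R + (a' <= a)%N%:R)).

(** Whether a step is allowed depends on the colour of its source only. Summing over these colours
    reduces walks on the 2N letters to powers of an N by N matrix. *)
Lemma wordsum_trace (K : comRingType) N (y : 'I_N -> K) t s i :
  wordsum (letter_weight y t) s i =
  \tr (transfer (fun a => y a ^+ i) (t ^+ i) ^+ s.+1).
Proof.
set M := transfer _ _.
pose wt a := letter_weight (fun a => y a ^+ i) (t ^+ i) a.
pose A (a b : letter N) := wt a * (allowed a b)%:R.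
have collapse n a (x : letter N) : \sum_b walksum A n (a, b) x = (M ^+ n.+1) a x.1.
  elim: n a => [|n IHn] a /=.
    rewrite expr1 big_bool /A /wt /letter_weight /allowed /= !mxE.
    by case: (_ <= _)%N; case: (_ <= _)%N; rewrite /=; ring.
  rewrite exprS mxE exchange_big /= sum_prod_type.
  apply: eq_bigr => a' _; rewrite -IHn mulr_sumr; apply: eq_bigr => b' _.
  rewrite -mulr_suml; congr (_ * _).
  rewrite big_bool /A /wt /letter_weight /allowed /= !mxE.
  by case: (_ <= _)%N; case: (_ <= _)%N; rewrite /=; ring.
transitivity (\sum_(w : word N s) \prod_(k < s.+1) A (w k) (w (ordS k))).
  rewrite /wordsum big_mkcond /=; apply: eq_bigr => w _.
  rewrite /A big_split /= /wweight -prodrXl.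
  have -> : \prod_(k < s.+1) (allowed (w k) (w (ordS k)))%:R = (allowedw w)%:R :> K.
    rewrite -natr_prod; congr (_%:R).
    have wS (k : 'I_s.+1) : letter_at w k.+1 = w (ordS k).
      by rewrite /letter_at; congr (w _); apply: val_inj; rewrite /= inordK ?ltn_mod.
    case: (boolP (allowedw w)) => [/forallP al|/forallPn[k]].
      by rewrite big1 // => k _; have := al k; rewrite wS letter_at_ord => ->.
    by rewrite wS letter_at_ord => /negbTE E; rewrite (bigD1 k) //= E.
  case: (allowedw w); rewrite ?mulr0 ?mulr1 //; apply: eq_bigr => k _.
  rewrite letter_at_ord /wt /letter_weight exprMn; congr (_ * _).
  by case: (w k).2; rewrite ?expr1n.
rewrite sum_closed_walks /mxtrace sum_prod_type.
apply: eq_bigr => a _; rewrite -(collapse s a (a, true)); apply: eq_bigr => b _.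
case: s => [|n]; first by case: b.
have ext q c c' x : walksum A q x (a, c) = walksum A q x (a, c').
  by elim: q x => //= q IHq x; apply: eq_bigr => z _; rewrite (IHq z).
exact: ext.
Qed.

Lemma sum_antidiag (R : pzRingType) (f : nat -> R) n :
  \sum_(j < n) \sum_(i < n - j) f (j + i)%N = \sum_(l < n) l.+1%:R * f l.
Proof.
elim: n => [|n IHn]; first by rewrite !big_ord0.
rewrite [RHS]big_ord_recr /= -IHn big_ord_recr /= subSnn big_ord_recl big_ord0 addr0 addn0.
rewrite (eq_bigr (fun j : 'I_n => \sum_(i < n - j) f (j + i)%N + f n)); last first.
  by move=> j _; rewrite subSn 1?ltnW // big_ord_recr /= subnKC // ltnW.
by rewrite big_split /= sumr_const card_ord -addrA -mulrSr mulr_natl.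
Qed.

(** * Traces of powers under a rank one update *)

Section RankOne.
Variables (K : comRingType) (N : nat) (A : 'M[K]_N) (u : 'cV[K]_N) (v : 'rV[K]_N).
Let M := A + u *m v.

Definition loop_weight j : K := (v *m A ^+ j *m u) 0 0.
(** Coefficients of 1 + z v (1 - z M)^-1 u, which by the rank one update formula is the inverse of 1
    - z v (1 - z A)^-1 u. The index is shifted to give the constant term 1; [openwS] is the
    inversion. *)
Definition openw l : K := if l is l'.+1 then (v *m M ^+ l' *m u) 0 0 else 1.
Let q l j : K := (v *m M ^+ l *m A ^+ j *m u) 0 0.

Let mul11 (x y : 'M[K]_1) : (x *m y) 0 0 = x 0 0 * y 0 0.
Proof. by rewrite mxE big_ord_recl big_ord0 addr0. Qed.

Lemma mixed_walks l j : q l j = \sum_(i < l.+1) openw (l - i) * loop_weight (j + i).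
Proof.
elim: l j => [|l IHl] j.
  by rewrite big_ord_recl big_ord0 addr0 addn0 mul1r /q expr0 mulmx1.
have -> : q l.+1 j = q l j.+1 + openw l.+1 * loop_weight j.
  rewrite /q /openw /loop_weight -mul11 exprSr {2}/M mulrDr -mulmxE mulmxDr !mulmxDl mxE.
  by congr (_ + _); [rewrite exprS -mulmxE|]; rewrite !mulmxA.
rewrite big_ord_recl subn0 addn0 addrC; congr (_ + _); rewrite IHl.
by apply: eq_bigr => i _; rewrite ?lift0 /bump /= ?add1n subSS addSnnS.
Qed.

(** Coefficient form of the logarithmic derivative of det(1 - z M) = det(1 - z A) (1 - z v (1 - z
    A)^-1 u). The proof replaces the factors M by A one at a time under the trace. *)
Lemma trace_rank_one s :
  \tr (M ^+ s) = \tr (A ^+ s) + \sum_(l < s) l.+1%:R * (openw (s.-1 - l) * loop_weight l).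
Proof.
have step j l : \tr (A ^+ j *m M ^+ l.+1) = \tr (A ^+ j.+1 *m M ^+ l) + q l j.
  rewrite exprS {1}/M mulrDl -mulmxE mulmxDr mxtraceD; congr (_ + _).
    by rewrite exprSr -mulmxE !mulmxA.
  have -> : A ^+ j *m (u *m v *m M ^+ l) = (A ^+ j *m u) *m (v *m M ^+ l).
    by rewrite !mulmxA.
  by rewrite mxtrace_mulC /mxtrace big_ord_recl big_ord0 addr0 /q !mulmxA.
have tele j l : \tr (A ^+ j *m M ^+ l) =
    \tr (A ^+ (j + l)) + \sum_(i < l) q (l.-1 - i) (j + i).
  elim: l j => [|l IHl] j; first by rewrite big_ord0 addr0 addn0 expr0 mulmx1.
  rewrite step IHl big_ord_recl /= addn0 subn0 addSnnS -addrA; congr (_ + _).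
  rewrite addrC; congr (_ + _); apply: eq_bigr => i _; rewrite ?lift0 /bump /= ?add1n addSnnS.
  by congr q; have := ltn_ord i; lia.
have := tele 0%N s; rewrite expr0 mul1mx add0n => ->; congr (_ + _).
rewrite -(sum_antidiag (fun l => openw (s.-1 - l) * loop_weight l)); apply: eq_bigr => j _.
rewrite add0n mixed_walks (_ : (s.-1 - j).+1 = (s - j)%N); last by have := ltn_ord j; lia.
by apply: eq_bigr => i _; rewrite subnDA.
Qed.

Lemma openwS l : openw l.+1 = \sum_(i < l.+1) openw (l - i) * loop_weight i.
Proof.
have := mixed_walks l 0; rewrite /q expr0 mulmx1 => E; exact: E.
Qed.

End RankOne.

(* One factor (1 - y z) / (1 - t y z) is multiplied into the series G. *)
Lemma newton_step (K : comRingType) (G G' q : nat -> K) (y t : K) :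
  G 0%N = 1 -> G' 0%N = 1 ->
  (forall i, G' i.+1 = t * y * G' i + G i.+1 - y * G i) ->
  (forall i, i%:R * G i = \sum_(j < i) q j.+1 * G (i.-1 - j)%N) ->
  forall i, i%:R * G' i =
    \sum_(j < i) (q j.+1 + (t ^+ j.+1 - 1) * y ^+ j.+1) * G' (i.-1 - j)%N.
Proof.
move=> G0 G'0 rec H.
(* The series x z / (1 - x z) times that of G'; its first factor is the logarithmic derivative (with
   z d/dz) of 1 / (1 - x z). *)
pose C x i := \sum_(j < i) x ^+ j.+1 * G' (i.-1 - j)%N.
have CS x i : C x i.+1 = x * (G' i + C x i).
  rewrite /C big_ord_recl subn0 expr1 mulrDr mulr_sumr; congr (_ + _).
  by apply: eq_bigr => j _; rewrite ?lift0 /bump /= ?add1n exprS mulrA; congr (_ * G' _); lia.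
pose A i := \sum_(j < i) q j.+1 * G' (i.-1 - j)%N.
have AS i : A i.+1 = t * y * A i + i.+1%:R * G i.+1 - y * (i%:R * G i).
  rewrite !H /A !big_ord_recr /= subnn G0 G'0 !mulr_sumr.
  have -> : \sum_(j < i) q j.+1 * G' (i - j)%N =
    \sum_(j < i) t * y * (q j.+1 * G' (i.-1 - j)%N) +
    \sum_(j < i) q j.+1 * G (i - j)%N - \sum_(j < i) y * (q j.+1 * G (i.-1 - j)%N).
    rewrite -big_split -sumrB /=; apply: eq_bigr => j _.
    have -> : (i - j = (i.-1 - j).+1)%N by have := ltn_ord j; lia.
    by rewrite rec; ring.
  by ring.
have ES i : C y i.+1 = t * y * C y i + y * G i.
  elim: i => [|i IHi]; first by rewrite CS /C !big_ord0 G0 G'0; ring.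
  by rewrite [in RHS]CS [in LHS]CS rec IHi; ring.
have Z i : A i + C (t * y) i - C y i = i%:R * G' i.
  elim: i => [|i IHi]; first by rewrite /A /C !big_ord0; ring.
  rewrite AS CS ES rec -[in RHS]natr1; move: IHi; set a := A i; set c := C _ i; set e := C _ i.
  move=> IHi; have -> : a = i%:R * G' i - c + e by rewrite -IHi; ring.
  by rewrite -natr1; ring.
move=> i; rewrite -Z /A /C -big_split -sumrB /=; apply: eq_bigr => j _.
by rewrite exprMn; ring.
Qed.

Section Transfer.
Variables (K : idomainType) (N : nat) (y : 'I_N -> K) (t : K).

Definition tri : 'M[K]_N :=
  \matrix_(a, a') (y a * (t * (a == a')%:R + (t - 1) * (a < a')%N%:R)).
Definition ycol : 'cV[K]_N := \col_a y a.
Definition ones : 'rV[K]_N := const_mx 1.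
Definition powsum j : K := \sum_a y a ^+ j.

Lemma transfer_rank_one : transfer y t = tri + ycol *m ones.
Proof.
apply/matrixP => a a'; rewrite !mxE big_ord_recl big_ord0 !mxE addr0 -val_eqE /=.
by case: ltngtP => _ /=; ring.
Qed.

Lemma trace_tri s : \tr (tri ^+ s) = t ^+ s * powsum s.
Proof.
have H k : (forall a a' : 'I_N, (a' < a)%N -> (tri ^+ k) a a' = 0) /\
    (forall a, (tri ^+ k) a a = (y a * t) ^+ k).
  elim: k => [|k [IH0 IH1]].
    split=> [a a' lt|a]; rewrite expr0 mxE ?eqxx //.
    by rewrite -val_eqE gtn_eqF.
  have tri0 (a b : 'I_N) : (b < a)%N -> tri a b = 0.
    by move=> lt; rewrite mxE -val_eqE gtn_eqF //= ltnNge ltnW //=; ring.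
  split=> [a a' lt|a]; rewrite exprS mxE.
    rewrite big1 // => b _; have [ba|ab] := ltnP b a; first by rewrite tri0 ?mul0r.
    by rewrite IH0 ?mulr0 // (leq_trans lt).
  rewrite (bigD1 a) //= big1 ?addr0 => [|b ba].
    by rewrite IH1 mxE eqxx ltnn exprS /=; ring.
  have [lt|] := ltnP b a; first by rewrite tri0 ?mul0r.
  rewrite leq_eqVlt val_eqE eq_sym (negbTE ba) /= => lt.
  by rewrite IH0 ?mulr0.
rewrite /mxtrace /powsum mulr_sumr; apply: eq_bigr => a _.
by have [_ ->] := H s; rewrite exprMn mulrC.
Qed.

Definition kappa l := loop_weight tri ycol ones l.

Let g j a : K := (tri ^+ j *m ycol) a 0.
(** Coefficients of the product over a >= c of (1 - y_a z) / (1 - t y_a z): [G_rec] adds one factor.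
    For c = 0 they are t - 1 times [kappa], shifted by one. *)
Let G c i : K := if i is i'.+1 then (t - 1) * \sum_(a < N | (c <= a)%N) g i' a else 1.

Let sum_geS (F : 'I_N -> K) (a : 'I_N) :
  \sum_(b < N | (a <= b)%N) F b = F a + \sum_(b < N | (a < b)%N) F b.
Proof.
rewrite (bigD1 a) //=; congr (_ + _); apply: eq_bigl => b.
by rewrite ltn_neqAle andbC eq_sym.
Qed.

Let G_rec (a : 'I_N) i : G a i.+1 = t * y a * G a i + G a.+1 i.+1 - y a * G a.+1 i.
Proof.
have gS j : g j.+1 a = y a * (t * g j a + (t - 1) * \sum_(b < N | (a < b)%N) g j b).
  rewrite {1}/g exprS -mulmxE -mulmxA mxE (eq_bigr (fun b : 'I_N =>
    y a * t * ((b == a)%:R * g j b) + y a * (t - 1) * ((a < b)%N%:R * g j b))); last first.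
    by move=> b _; rewrite -/(g j b) mxE eq_sym; ring.
  rewrite big_split /= -!mulr_sumr (bigD1 a) //= eqxx mul1r big1 ?addr0; last first.
    by move=> b /negbTE ->; rewrite mul0r.
  rewrite [in RHS]big_mkcond /= (eq_bigr (fun b : 'I_N => if (a < b)%N then g j b else 0)); last first.
    by move=> b _; case: ifP; rewrite ?mul1r ?mul0r.
  by ring.
rewrite /G; case: i => [|i]; rewrite !sum_geS.
  by rewrite {1}/g expr0 mul1mx mxE; ring.
by rewrite gS; ring.
Qed.

(** Newton's recursion for the full product of (1 - y_a z) / (1 - t y_a z), divided by t - 1; the
    sum of the powers of t is (t^(l+1) - 1) / (t - 1). *)
Lemma kappa_newton l : t != 1 ->
  l.+1%:R * kappa l = (\sum_(i < l.+1) t ^+ i) * powsum l.+1 +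
    \sum_(j < l) (t ^+ j.+1 - 1) * powsum j.+1 * kappa (l.-1 - j).
Proof.
move=> t1; pose q c j : K := (t ^+ j - 1) * \sum_(a < N | (c <= a)%N) y a ^+ j.
have H c : (c <= N)%N -> forall i,
    i%:R * G c i = \sum_(j < i) q c j.+1 * G c (i.-1 - j).
  move=> cN; rewrite -(subKn cN); elim: (N - c)%N (leq_subr c N) => [_ i|k IHk kN].
    have E0 (F : 'I_N -> K) : \sum_(a < N | (N - 0 <= a)%N) F a = 0.
      by rewrite big_pred0 // => a; rewrite subn0 leqNgt ltn_ord.
    rewrite big1 => [|j _]; last by rewrite /q E0 mulr0 mul0r.
    by case: i => [|i]; rewrite ?mul0r //= E0 !mulr0.
  have lt : (N - k.+1 < N)%N by rewrite ltn_subrL (leq_trans _ kN).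
  have Ec : (N - k.+1).+1 = (N - k)%N by rewrite subnSK.
  move=> i; have := @newton_step _ (G (N - k)) (G (N - k.+1)) (q (N - k)%N) (y (Ordinal lt)) t.
  move=> -> //; last first.
  - exact: IHk (ltnW kN).
  - by move=> j; have := G_rec (Ordinal lt) j; rewrite /= Ec.
  apply: eq_bigr => j _; congr (_ * _); rewrite /q.
  by have := sum_geS (fun a => y a ^+ j.+1) (Ordinal lt); rewrite /= Ec => ->; ring.
have Gk j : G 0 j.+1 = (t - 1) * kappa j.
  rewrite /G /kappa /loop_weight -mulmxA [in RHS]mxE; congr (_ * _).
  by apply: eq_bigr => a _; rewrite mxE mul1r.
have qE j : q 0%N j = (t ^+ j - 1) * powsum j by rewrite /q.
have tm1 : t - 1 != 0 by rewrite subr_eq0.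
apply: (mulfI tm1); have := H 0%N isT l.+1.
rewrite big_ord_recr /= subnn mulr1 qE -/(G 0%N l.+1) Gk mulrCA => ->.
rewrite subrX1 mulrDr addrC mulrA; congr (_ + _); rewrite mulr_sumr.
apply: eq_bigr => j _; have -> : (l - j = (l.-1 - j).+1)%N by have := ltn_ord j; lia.
by rewrite -/(G 0%N _.+1) Gk qE; ring.
Qed.

Lemma trace_transfer s : \tr (transfer y t ^+ s) =
  t ^+ s * powsum s +
  \sum_(l < s) l.+1%:R * (openw tri ycol ones (s.-1 - l) * kappa l).
Proof. by rewrite transfer_rank_one trace_rank_one trace_tri. Qed.

End Transfer.

(** * Specialization of the recursions *)

Lemma sum_multiples (R : nmodType) (F : nat -> R) f g : (0 < f)%N ->
  \sum_(j < f * g) (if (f %| j.+1)%N then F (j.+1 %/ f)%N else 0) =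
  \sum_(h < g) F h.+1.
Proof.
case: f => // f _; elim: g => [|g IHg]; first by rewrite muln0 !big_ord0.
rewrite mulnSr big_split_ord /= IHg [in RHS]big_ord_recr; congr (_ + _).
rewrite big_ord_recr /= big1 ?add0r => [|j _].
  by rewrite -addnS -mulnSr dvdn_mulr // mulKn.
rewrite -addnS dvdn_addr ?dvdn_mulr // gtnNdvd //.
by rewrite ltnS.
Qed.

(* The images of kappa, openw and of the traces under p_f = 1, p_j = 0 (j <> f),
   where tau stands for t; they vanish outside multiples of f. *)
Section Spec.
Variables (f' : nat) (tau : {poly rat}).
Let f := f'.+1.
Let Q : {poly rat} := \sum_(j < f) tau ^+ j.
Let c g : rat := ((f ^ g * g`!)%N%:R)^-1.
Let A g := eulerian g \Po tau.

(** At p_f = 1 the product of (1 - y z) / (1 - tau y z) becomes exp((tau^f - 1) z^f / f); these are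
    its coefficients of z^(l+1) divided by tau - 1. *)
Definition kappa_spec l : {poly rat} :=
  if (f %| l.+1)%N then
    let g := (l.+1 %/ f)%N in (c g)%:P * (Q ^+ g * (tau - 1) ^+ g.-1)
  else 0.

(** The exponential series (tau - 1) / (tau - exp((tau - 1) x)) of the Eulerian polynomials at x = Q
    z^f / f. *)
Definition openw_spec l : {poly rat} :=
  if (f %| l)%N then let g := (l %/ f)%N in (c g)%:P * (Q ^+ g * A g) else 0.

(** The correction at g = 1 is needed because the trace is then 1 + tau + ... + tau^f, one term more
    than tau Q. *)
Definition trace_spec s : {poly rat} :=
  if (f %| s)%N then let g := (s %/ f)%N in
    (s%:R * c g)%:P * (tau * A g.-1 * Q ^+ g + (g == 1%N)%:R) else 0.

Let cS g : (f * g.+1)%:R * c g.+1 = c g.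
Proof.
rewrite /c factS !natrM !natrX; have f0 : f%:R != 0 :> rat by rewrite pnatr_eq0.
have g0 : g.+1%:R != 0 :> rat by rewrite pnatr_eq0.
have F0 : g`!%:R != 0 :> rat by rewrite pnatr_eq0 -lt0n fact_gt0.
move: (f%:R : rat) (g.+1%:R : rat) (g`!%:R : rat) f0 g0 F0 => x y z x0 y0 z0.
by rewrite exprS; move: (x ^+ g) (expf_neq0 g x0) => X X0; field; rewrite x0 y0 z0 X0.
Qed.

Let c0 : c 0 = 1.
Proof. by rewrite /c expn0 fact0 mul1n invr1. Qed.

Let c_bin g h : (h <= g)%N -> c (g - h) * c h = 'C(g, h)%:R * c g.
Proof.
move=> hg; have Eg : (f ^ g = f ^ (g - h) * f ^ h)%N by rewrite -expnD subnK.
rewrite /c -(bin_fact hg) Eg !natrM !natrX.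
have f0 : f%:R != 0 :> rat by rewrite pnatr_eq0.
have F0 q : q`!%:R != 0 :> rat by rewrite pnatr_eq0 -lt0n fact_gt0.
have B0 : 'C(g, h)%:R != 0 :> rat by rewrite pnatr_eq0 -lt0n bin_gt0.
move: (f%:R : rat) ('C(g, h)%:R : rat) f0 B0 => x y x0 y0.
move: (x ^+ (g - h)) (x ^+ h) (expf_neq0 (g - h) x0) (expf_neq0 h x0) => X Y X0 Y0.
by field; rewrite X0 Y0 y0 !F0.
Qed.

Lemma kappa_spec_rec l : l.+1%:R * kappa_spec l = (l.+1 == f)%:R * (\sum_(j < l.+1) tau ^+ j) +
  \sum_(j < l) (j.+1 == f)%:R * (tau ^+ j.+1 - 1) * kappa_spec (l.-1 - j).
Proof.
have sumE : \sum_(j < l) (j.+1 == f)%:R * (tau ^+ j.+1 - 1) * kappa_spec (l.-1 - j) =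
    if (f <= l)%N then (tau ^+ f - 1) * kappa_spec (l - f) else 0.
  case: (leqP f l) => [fl|lf].
    rewrite (bigD1 (Ordinal fl)) //= eqxx mul1r big1 ?addr0.
      by congr (_ * kappa_spec _); lia.
    by move=> j; rewrite -val_eqE /= eqSS => /negbTE ->; rewrite !mul0r.
  rewrite big1 // => j _; have -> : (j.+1 == f) = false by have := ltn_ord j; lia.
  by rewrite !mul0r.
rewrite sumE /kappa_spec; case: (boolP (f %| l.+1)%N) => [/dvdnP[g El]|ndv].
  rewrite El mulnK //; case: g El => [|[|g]] El; first by rewrite mul0n in El.
    rewrite mul1n in El *; have -> : (f <= l)%N = false by lia.
    rewrite eqxx mul1r addr0 expr1 expr0 mulr1 -/Q mulrA -(rmorph_nat (@polyC rat)).
    have := cS 0; rewrite muln1 -polyCM => ->.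
    by rewrite c0 mul1r.
  have -> : (f <= l)%N by rewrite -ltnS El; nia.
  have -> : (g.+2 * f == f) = false by apply/eqP; nia.
  have E2 : (l - f).+1 = (g.+1 * f)%N by rewrite mulSn in El; lia.
  rewrite mul0r add0r E2 dvdn_mull // mulnK // -/Q subrX1 -/Q -(rmorph_nat (@polyC rat)).
  rewrite mulrA -polyCM [(g.+2 * f)%N]mulnC cS /= !exprS; ring.
have -> : (l.+1 == f) = false by apply: contraNF ndv => /eqP ->.
rewrite mulr0 mul0r add0r; case: (leqP f l) => // fl.
have -> : (f %| (l - f).+1)%N = false.
  by apply: contraNF ndv => H; rewrite -(subnK (leqW fl)) subSn // dvdn_addl.
by rewrite mulr0.
Qed.

Lemma openw_spec0 : openw_spec 0 = 1.
Proof.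
rewrite /openw_spec dvdn0 div0n c0 expr0 !mul1r /A.
rewrite /eulerian (eq_bigr (fun=> 1)) ?sumr_const ?card_Sn ?comp_polyC // => w _.
by rewrite excE big_ord0.
Qed.

Let A_rec g : (0 < g)%N ->
  A g = \sum_(l < g) 'C(g, l.+1)%:R * (tau - 1) ^+ l * A (g.-1 - l).
Proof.
move=> g0; rewrite {1}/A eulerian_binomial_rec // raddf_sum; apply: eq_bigr => l _.
rewrite /= !comp_polyM -(rmorph_nat (@polyC rat)) comp_polyC; congr (_ * _ * _).
have -> : forall k, ('X - 1 : {poly rat}) ^+ k \Po tau = (tau - 1) ^+ k.
  elim=> [|k IHk]; first by rewrite !expr0 comp_polyC.
  by rewrite !exprS comp_polyM IHk comp_polyB comp_polyX comp_polyC.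
by [].
Qed.

Let openw_kappa_spec l j g : l.+1 = (g * f)%N -> (j <= l)%N ->
  openw_spec (l - j) * kappa_spec j = if (f %| j.+1)%N then let h := (j.+1 %/ f)%N in
   (c g)%:P * Q ^+ g * ('C(g, h)%:R * (tau - 1) ^+ h.-1 * A (g - h)) else 0.
Proof.
move=> El jl; rewrite /openw_spec /kappa_spec; case: (boolP (f %| j.+1)%N) => [/dvdnP[h Ej]|_]; last first.
  by rewrite mulr0.
have Elj : (l - j = (g - h) * f)%N by rewrite mulnBl; lia.
have hg : (h <= g)%N by rewrite -(leq_pmul2r (ltn0Sn f')) -/f -Ej -El ltnS.
rewrite Elj dvdn_mull // Ej !mulnK //.
have -> : Q ^+ g = Q ^+ (g - h) * Q ^+ h by rewrite -exprD subnK.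
transitivity ((c (g - h) * c h)%:P *
  (Q ^+ (g - h) * A (g - h) * (Q ^+ h * (tau - 1) ^+ h.-1))).
  by rewrite polyCM; ring.
by rewrite c_bin // polyCM rmorph_nat; ring.
Qed.

Lemma openw_spec_rec l : openw_spec l.+1 = \sum_(j < l.+1) openw_spec (l - j) * kappa_spec j.
Proof.
case: (boolP (f %| l.+1)%N) => [/dvdnP[g El]|ndv]; last first.
  rewrite /openw_spec (negbTE ndv) big1 // => j _; rewrite /kappa_spec.
  case: ifP => dlj; rewrite ?mul0r //; case: ifP => dj; rewrite ?mulr0 //.
  have jl : (j <= l)%N by rewrite -ltnS.
  have E : l.+1 = (l - j + j.+1)%N by rewrite addnS subnK.
  by case/negP: ndv; rewrite E dvdn_add.
pose F h := (c g)%:P * Q ^+ g * ('C(g, h)%:R * (tau - 1) ^+ h.-1 * A (g - h)).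
rewrite (eq_bigr (fun j : 'I_l.+1 => if (f %| j.+1)%N then F (j.+1 %/ f)%N else 0)).
  rewrite [in RHS]El [in RHS]mulnC (sum_multiples F) // /openw_spec El dvdn_mull // mulnK //.
  have g0 : (0 < g)%N by rewrite lt0n; apply: contra_eq_neq El => ->; rewrite mul0n.
  rewrite mulrA {1}A_rec // mulr_sumr; apply: eq_bigr => h _ /=.
  by rewrite /F -subn1 -subnDA add1n.
by move=> j _; rewrite (openw_kappa_spec El) // -ltnS.
Qed.

Lemma trace_spec_rec s : (0 < s)%N ->
  (s == f)%:R * tau ^+ s + \sum_(l < s) l.+1%:R * (openw_spec (s.-1 - l) * kappa_spec l) = trace_spec s.
Proof.
case: s => // s _ /=; rewrite /trace_spec.
case: (boolP (f %| s.+1)%N) => [/dvdnP[g El]|ndv]; last first.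
  have -> : (s.+1 == f) = false by apply: contraNF ndv => /eqP ->.
  rewrite mul0r add0r big1 // => j _; rewrite /openw_spec /kappa_spec.
  case: ifP => dlj; rewrite ?mul0r ?mulr0 //; case: ifP => dj; rewrite ?mulr0 //.
  have jl : (j <= s)%N by rewrite -ltnS.
  have E : s.+1 = (s - j + j.+1)%N by rewrite addnS subnK.
  by case/negP: ndv; rewrite E dvdn_add.
have g0 : (0 < g)%N by rewrite lt0n; apply: contra_eq_neq El => ->; rewrite mul0n.
pose F h := (h * f)%:R * ((c g)%:P * Q ^+ g *
       ('C(g, h)%:R * (tau - 1) ^+ h.-1 * A (g - h))).
have -> : \sum_(l < s.+1) l.+1%:R * (openw_spec (s - l) * kappa_spec l) =
   \sum_(l < s.+1) (if (f %| l.+1)%N then F (l.+1 %/ f)%N else 0).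
  apply: eq_bigr => l _; rewrite (openw_kappa_spec El) -1?ltnS //.
  by case: ifP => dl; rewrite ?mulr0 //= /F divnK.
rewrite [X in _ + X = _](_ : _ = (s.+1%:R * c g)%:P * Q ^+ g *
   \sum_(h < g) 'C(g.-1, h)%:R * (tau - 1) ^+ h * A (g.-1 - h)); last first.
  rewrite El [in LHS]mulnC (sum_multiples F) // mulr_sumr; apply: eq_bigr => h _.
  have -> : (g.-1 - h = g - h.+1)%N by lia.
  rewrite /F /= polyCM rmorph_nat natrM.
  (* The weight h + 1 of the loop is absorbed into the binomial coefficient, lowering g to g - 1 so
     that [A_rec] applies at g - 1. *)
  have := mul_bin_diag g h => /(congr1 (fun k => k%:R : {poly rat})); rewrite !natrM => E.
  transitivity (h.+1%:R * 'C(g, h.+1)%:R * (f%:R * (c g)%:P * Q ^+ g *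
     ((tau - 1) ^+ h * A (g - h.+1)))); first by ring.
  by rewrite -E; ring.
rewrite El mulnK // -[in RHS]El.
clear F; case: g g0 El => [//|[|g]] _ El.
  rewrite mul1n in El *; rewrite El !eqxx mul1r big_ord_recl big_ord0 addr0 bin0 expr0 /= !mul1r.
  have -> : f%:R * c 1 = 1 by have := cS 0; rewrite muln1 => ->; rewrite c0.
  have -> : A 0 = 1 by have := openw_spec0; rewrite /openw_spec dvdn0 div0n c0 expr0 !mul1r.
  rewrite mul1r expr1 !mulr1 polyC1 mul1r /Q mulr_sumr [LHS]addrC [RHS]addrC.
  have -> : \sum_(i < f) tau ^+ i + tau ^+ f = \sum_(i < f.+1) tau ^+ i.
    by rewrite [RHS]big_ord_recr.
  rewrite big_ord_recl expr0; congr (_ + _).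
  by apply: eq_bigr => i _; rewrite lift0 exprS.
have -> : (g.+2 * f == f) = false by apply/eqP; nia.
rewrite -El mul0r add0r addr0 -mulrA; congr (_ * _); rewrite [RHS]mulrC; congr (_ * _).
(* The terms after the first are tau - 1 times the recursion of A (g + 1), so that altogether tau A
   (g + 1) remains. *)
rewrite big_ord_recl bin0 expr0 !mul1r subn0 [X in _ + X](_ : _ = (tau - 1) * A g.+1).
  by rewrite /=; ring.
rewrite [in RHS]A_rec // mulr_sumr; apply: eq_bigr => h _.
by rewrite lift0 /= exprS; ring.
Qed.

End Spec.

(** * Power sum expansions over Q[t] *)

(* Symmetric functions over Q[t]: the variable t is 'X. *)
Notation tfam := (forall N, {poly {mpoly rat[N]}}).

Definition tscal N (c : {poly rat}) : {poly {mpoly rat[N]}} :=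
  map_poly (@mpolyC N rat) c.
HB.instance Definition _ N := GRing.RMorphism.copy (@tscal N) (map_poly (@mpolyC N rat)).

Section PExp.
Variable d : nat.

(* [u] is the image of [sum_(c, nu) c p_nu], homogeneous of degree [D], and [a]
   is the value of that polynomial at p_d = 1, p_j = 0 for j <> d. *)
Definition pexp D (u : tfam) (a : {poly rat}) : Prop :=
  exists l : seq ({poly rat} * seq nat),
  [/\ all (fun q => (0%N \notin q.2) && (sumn q.2 == D)) l,
      forall N, u N = \sum_(q <- l) tscal N q.1 * (psum q.2 N)%:P
    & a = \sum_(q <- l | all (pred1 d) q.2) q.1].

Lemma pexp_ext D u u' a a' : (forall N, u N = u' N) -> a = a' ->
  pexp D u a -> pexp D u' a'.
Proof. by move=> E <- [l [H1 H2 H3]]; exists l; split=> // N; rewrite -E. Qed.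

Lemma pexp0 D : pexp D (fun N => 0) 0.
Proof. by exists [::]; split=> // [N|]; rewrite big_nil. Qed.

Lemma pexpD D u u' a a' : pexp D u a -> pexp D u' a' ->
  pexp D (fun N => u N + u' N) (a + a').
Proof.
move=> [l [H1 H2 H3]] [l' [H1' H2' H3']]; exists (l ++ l').
by split=> [|N|]; rewrite ?all_cat ?H1 ?big_cat /= ?H2 ?H2' ?H3 ?H3'.
Qed.

Lemma pexpZ D c u a : pexp D u a -> pexp D (fun N => tscal N c * u N) (c * a).
Proof.
move=> [l [H1 H2 H3]]; exists [seq (c * q.1, q.2) | q <- l]; split=> [|N|].
- by rewrite all_map; apply: sub_all H1.
- by rewrite H2 big_map mulr_sumr; apply: eq_bigr => q _ /=; rewrite rmorphM mulrA.
- by rewrite H3 big_map mulr_sumr.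
Qed.

Lemma pexpM D D' u u' a a' : pexp D u a -> pexp D' u' a' ->
  pexp (D + D')%N (fun N => u N * u' N) (a * a').
Proof.
move=> [l [H1 H2 H3]] [l' [H1' H2' H3']].
exists [seq (q.1 * q'.1, q.2 ++ q'.2) | q <- l, q' <- l']; split=> [|N|].
- apply/allP => _ /allpairsP[[q q'] /= [ql ql' ->]] /=.
  have /andP[q0 /eqP qs] := allP H1 _ ql; have /andP[q0' /eqP qs'] := allP H1' _ ql'.
  by rewrite mem_cat negb_or q0 q0' sumn_cat qs qs' /=.
- rewrite H2 H2' big_allpairs_dep mulr_suml; apply: eq_bigr => q _.
  rewrite mulr_sumr; apply: eq_bigr => q' _ /=.
  by rewrite rmorphM /psum big_cat /= polyCM; ring.
- rewrite H3 H3' mulr_suml [LHS]big_mkcond [RHS]big_mkcond [RHS]big_allpairs_dep /=.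
  apply: eq_bigr => q _; under [RHS]eq_bigr do rewrite all_cat.
  by case: (all _ q.2); rewrite /= ?big1_eq // mulr_sumr big_mkcond.
Qed.

Lemma pexp1 : pexp 0 (fun N => 1) 1.
Proof.
exists [:: (1, [::])]; split=> // [N|]; last by rewrite big_mkcond big_seq1.
by rewrite big_seq1 /psum big_nil rmorph1 mulr1.
Qed.

Lemma pexp_psum j : (0 < j)%N -> pexp j (fun N => (psum [:: j] N)%:P) (j == d)%:R.
Proof.
move=> j0; exists [:: (1, [:: j])]; split=> [|N|].
- by rewrite /= mem_seq1 eq_sym -lt0n j0 addn0 eqxx.
- by rewrite big_seq1 rmorph1 mul1r.
- by rewrite big_mkcond big_seq1 /= andbT; case: eqP.
Qed.

Lemma pexp_sum D n (P : pred 'I_n) (u : 'I_n -> tfam) a :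
  (forall i, P i -> pexp D (u i) (a i)) ->
  pexp D (fun N => \sum_(i < n | P i) u i N) (\sum_(i < n | P i) a i).
Proof.
move=> H; suff Hs (r : seq 'I_n) : pexp D (fun N => \sum_(i <- r | P i) u i N)
  (\sum_(i <- r | P i) a i) by exact: Hs.
elim: r => [|i r IHr].
  by apply: pexp_ext (pexp0 D) => [N|]; rewrite big_nil.
case: (boolP (P i)) => Pi.
  by apply: pexp_ext (pexpD (H i Pi) IHr) => [N|]; rewrite big_cons Pi.
by apply: pexp_ext IHr => [N|]; rewrite big_cons (negbTE Pi).
Qed.

Lemma pexpN D u a : pexp D u a -> pexp D (fun N => - u N) (- a).
Proof.
by move/(pexpZ (-1)); apply: pexp_ext => [N|]; rewrite ?rmorphN1 mulN1r.
Qed.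

Lemma pexp_divn D n u a : (0 < n)%N -> pexp D (fun N => n%:R * u N) a ->
  pexp D u ((n%:R^-1)%:P * a).
Proof.
move=> n0 /(pexpZ (n%:R^-1)%:P); apply: pexp_ext => [N|//].
rewrite mulrA -(rmorph_nat (@tscal N)) -rmorphM -(rmorph_nat (@polyC rat)) -polyCM.
by rewrite mulVf ?rmorph1 ?mul1r // pnatr_eq0 -lt0n.
Qed.

End PExp.

(** The reversal undoes the decreasing numbering of values in letters. *)
Definition xvar N (a : 'I_N) : {poly {mpoly rat[N]}} := ('X_(rev_ord a))%:P.

Lemma powsum_xvar N i j :
  powsum (fun a : 'I_N => xvar a ^+ i) j = (psum [:: (i * j)%N] N)%:P.
Proof.
rewrite /psum big_seq1 rmorph_sum /powsum (reindex_inj rev_ord_inj) /=.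
by apply: eq_bigr => a _; rewrite /xvar rev_ordK -exprM rmorphXn.
Qed.

Lemma tscalX N : tscal N 'X = 'X.
Proof. exact: map_polyX. Qed.

Section Specialize.
Variables (d i : nat).
Hypothesis i_gt0 : (0 < i)%N.

Definition kapF l : tfam := fun N => kappa (fun a : 'I_N => xvar a ^+ i) 'X^i l.

Definition openF l : tfam := fun N =>
  openw (tri (fun a : 'I_N => xvar a ^+ i) 'X^i) (ycol (fun a : 'I_N => xvar a ^+ i))
    (ones _ N) l.

(** In the variables x^i the power sum p_j becomes p_(i j). So p_d = 1 turns into p_f = 1 with f = d
    / i, or makes every power sum vanish if i does not divide d. The argument handed to [F] is f -
    1. *)
Definition spec (F : nat -> {poly rat} -> {poly rat}) : {poly rat} :=
  if (i %| d)%N then F (d %/ i).-1 'X^i else 0.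

Let XiE N j : ('X^i : {poly {mpoly rat[N]}}) ^+ j = tscal N ('X^i ^+ j).
Proof. by rewrite !(rmorphXn (@tscal N)) /= tscalX. Qed.

Hypothesis d_gt0 : (0 < d)%N.

Let f_gt0 : (i %| d)%N -> (d %/ i).-1.+1 = (d %/ i)%N.
Proof. by move=> id; rewrite prednK // divn_gt0 // dvdn_leq. Qed.

Let delta j : (i %| d)%N -> (i * j == d)%N = (j == (d %/ i).-1.+1).
Proof. by move=> id; rewrite f_gt0 // mulnC -{1}(divnK id) eqn_pmul2r. Qed.

Let deltaN j : ~~ (i %| d)%N -> (i * j == d)%N = false.
Proof. by move=> nid; apply: contraNF nid => /eqP <-; exact: dvdn_mulr. Qed.

Lemma pexp_kapF l : pexp d (i * l.+1)%N (kapF l) (spec (fun f t => kappa_spec f t l)).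
Proof.
elim/ltn_ind: l => l IH.
have H : pexp d (i * l.+1)%N (fun N => l.+1%:R * kapF l N)
   ((\sum_(j < l.+1) 'X^i ^+ j) * (i * l.+1 == d)%N%:R +
    \sum_(j < l) ('X^i ^+ j.+1 - 1) * ((i * j.+1 == d)%N%:R *
      spec (fun f t => kappa_spec f t (l.-1 - j)))).
  have : pexp d (i * l.+1)%N (fun N => tscal N (\sum_(j < l.+1) 'X^i ^+ j) *
      (psum [:: (i * l.+1)%N] N)%:P + \sum_(j < l) tscal N ('X^i ^+ j.+1 - 1) *
      ((psum [:: (i * j.+1)%N] N)%:P * kapF (l.-1 - j) N))
     ((\sum_(j < l.+1) 'X^i ^+ j) * (i * l.+1 == d)%N%:R +
      \sum_(j < l) ('X^i ^+ j.+1 - 1) * ((i * j.+1 == d)%N%:R *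
        spec (fun f t => kappa_spec f t (l.-1 - j)))).
    apply: pexpD; first by apply: pexpZ; apply: pexp_psum; rewrite muln_gt0 i_gt0.
    apply: pexp_sum => j _; apply: pexpZ.
    have -> : (i * l.+1 = i * j.+1 + i * (l.-1 - j).+1)%N.
      by rewrite -mulnDr; congr muln; have := ltn_ord j; lia.
    apply: pexpM; first by apply: pexp_psum; rewrite muln_gt0 i_gt0.
    by apply: IH; have := ltn_ord j; lia.
  apply: pexp_ext => // N; rewrite /kapF kappa_newton; last first.
    by rewrite -subr_eq0 -size_poly_eq0 size_XnsubC.
  rewrite powsum_xvar rmorph_sum; congr (_ * _ + _).
    by apply: eq_bigr => j _; rewrite XiE.
  by apply: eq_bigr => j _; rewrite powsum_xvar (rmorphB (@tscal N)) (rmorph1 (@tscal N)) /= -XiE mulrA.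
apply: pexp_ext (pexp_divn (ltn0Sn l) H) => //; rewrite /spec.
case: (boolP (i %| d)%N) => [id|nid]; last first.
  rewrite deltaN // mulr0 add0r big1 ?mulr0 // => j _.
  by rewrite !mulr0.
set rhs := (X in _ * X).
have -> : rhs = l.+1%:R * kappa_spec (d %/ i).-1 'X^i l.
  rewrite kappa_spec_rec /rhs delta // mulrC; congr (_ + _); apply: eq_bigr => j _.
  by rewrite delta //; ring.
rewrite mulrA -(rmorph_nat (@polyC rat)) -polyCM mulVf ?mul1r //.
by rewrite pnatr_eq0.
Qed.

Lemma pexp_openF l : pexp d (i * l)%N (openF l)
  (if (i %| d)%N then openw_spec (d %/ i).-1 'X^i l else (l == 0%N)%:R).
Proof.
elim/ltn_ind: l => -[|l] IH.
  by rewrite muln0; apply: pexp_ext (pexp1 d) => //; case: ifP => // _; rewrite openw_spec0.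
have : pexp d (i * l.+1)%N (fun N => \sum_(j < l.+1) openF (l - j) N * kapF j N)
   (\sum_(j < l.+1) (if (i %| d)%N then openw_spec (d %/ i).-1 'X^i (l - j)
      else ((l - j)%N == 0%N)%:R) * spec (fun f t => kappa_spec f t j)).
  apply: pexp_sum => j _.
  have -> : (i * l.+1 = i * (l - j) + i * j.+1)%N.
    by rewrite -mulnDr; congr muln; have := ltn_ord j; lia.
  by apply: pexpM; [apply: IH; lia|exact: pexp_kapF].
apply: pexp_ext => [N|]; first by rewrite /openF openwS.
rewrite /spec; case: ifP => _; first by rewrite openw_spec_rec.
by rewrite big1 // => j _; rewrite mulr0.
Qed.

Definition wordF s : tfam := fun N => wordsum (letter_weight (@xvar N) 'X) s i.

Lemma pexp_wordF s : pexp d (i * s.+1)%N (wordF s) (spec (fun f t => trace_spec f t s.+1)).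
Proof.
have : pexp d (i * s.+1)%N (fun N => tscal N ('X^i ^+ s.+1) * (psum [:: (i * s.+1)%N] N)%:P +
     \sum_(l < s.+1) tscal N l.+1%:R * (openF (s - l) N * kapF l N))
   ('X^i ^+ s.+1 * (i * s.+1 == d)%N%:R +
    \sum_(l < s.+1) l.+1%:R * ((if (i %| d)%N then openw_spec (d %/ i).-1 'X^i (s - l)
      else ((s - l)%N == 0%N)%:R) * spec (fun f t => kappa_spec f t l))).
  apply: pexpD; first by apply: pexpZ; apply: pexp_psum; rewrite muln_gt0 i_gt0.
  apply: pexp_sum => l _; apply: pexpZ.
  have -> : (i * s.+1 = i * (s - l) + i * l.+1)%N.
    by rewrite -mulnDr; congr muln; have := ltn_ord l; lia.
  by apply: pexpM; [exact: pexp_openF|exact: pexp_kapF].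
apply: pexp_ext => [N|].
  rewrite /wordF wordsum_trace trace_transfer powsum_xvar XiE; congr (_ + _).
  by apply: eq_bigr => l _; rewrite rmorph_nat.
rewrite /spec; case: (boolP (i %| d)%N) => [id|nid].
  by rewrite -trace_spec_rec // delta // mulrC.
by rewrite deltaN // mulr0 add0r big1 // => l _; rewrite !mulr0.
Qed.

End Specialize.

(** * Primitive words at p_d = 1 *)

Lemma coef_gcd_part f b c j :
  (gcd_part f b c)`_j = if gcdn j b == c then f`_j else 0.
Proof.
rewrite coef_poly; case: ltnP => // le; rewrite (nth_default _ le).
by case: ifP.
Qed.

Lemma tAq_comp f g i : tAq f g \Po 'X^i =
  'X^i * (eulerian g.-1 \Po 'X^i) * (\sum_(j < f) 'X^i ^+ j) ^+ g.
Proof.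
rewrite /tAq !comp_polyM comp_polyX; congr (_ * _).
have -> : forall k, (tint f ^+ k) \Po 'X^i = (tint f \Po 'X^i) ^+ k.
  elim=> [|k IHk]; first by rewrite !expr0 comp_polyC.
  by rewrite !exprS comp_polyM IHk.
rewrite /tint raddf_sum; congr (_ ^+ _); apply: eq_bigr => j _.
by rewrite /= comp_Xn_poly.
Qed.

(** The number g is the degree (s + 1) i divided by d. Polynomial and constant depend on s and i
    through (s + 1) i only; i by itself enters just as the selected gcd. *)
Definition prim_spec d s i : {poly rat} :=
  if (d %| s.+1 * i)%N then
    let g := (s.+1 * i %/ d)%N in
    ((s.+1 * i)%N%:R / (d ^ g * g`!)%N%:R)%:P * gcd_part (tAq d g + (g == 1%N)%:R) d i
  else 0.

(** All summands share the same polynomial and constant, and they split the exponents j divisible by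
    i according to gcd(j, d) = e i, where e divides s + 1. By [coef_tAq_mul] the coefficients at
    multiples of i are those for d / i, scaled by i^(g-1). *)
Lemma trace_spec_prim_spec d s i : (0 < i)%N -> (0 < d)%N ->
  spec d i (fun f t => trace_spec f t s.+1) =
  \sum_(p < s.+1 | (p.+1 %| s.+1)%N) prim_spec d p (s.+1 %/ p.+1 * i).
Proof.
move=> i_gt0 d_gt0; rewrite /spec.
have degE (p : nat) : (p.+1 %| s.+1)%N -> (p.+1 * (s.+1 %/ p.+1 * i) = s.+1 * i)%N.
  by move=> ps; rewrite mulnA [X in (X * i)%N]mulnC divnK.
have f1 : (i %| d)%N -> (d %/ i).-1.+1 = (d %/ i)%N.
  by move=> id; rewrite prednK // divn_gt0 // dvdn_leq.
case: (boolP (d %| s.+1 * i)%N) => [ds|nds]; last first.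
  rewrite big1 => [|p ps]; last by rewrite /prim_spec degE // (negbTE nds).
  case: ifP => [id|_]; last by [].
  rewrite /trace_spec f1; last exact: id.
  have -> : (d %/ i %| s.+1)%N = false; last by [].
  by apply: contraNF nds => fs; rewrite -(divnK id) dvdn_pmul2r.
set g := (s.+1 * i %/ d)%N.
have g_gt0 : (0 < g)%N by rewrite divn_gt0 // dvdn_leq // muln_gt0.
pose C : rat := (s.+1 * i)%N%:R / (d ^ g * g`!)%N%:R.
pose P : {poly rat} := tAq d g + (g == 1%N)%:R.
have -> : \sum_(p < s.+1 | (p.+1 %| s.+1)%N) prim_spec d p (s.+1 %/ p.+1 * i) =
    C%:P * \sum_(p < s.+1 | (p.+1 %| s.+1)%N) gcd_part P d (s.+1 %/ p.+1 * i).
  by rewrite mulr_sumr; apply: eq_bigr => p ps; rewrite /prim_spec degE // ds.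
have [nid|id] := boolP (~~ (i %| d)%N).
  rewrite (negbTE nid) big1 ?mulr0 // => p ps; apply/polyP => j; rewrite coef_gcd_part coef0.
  case: eqP => [E|_]; last by [].
  by case/negP: nid; rewrite (@dvdn_trans (gcdn j d)) ?dvdn_gcdr // E dvdn_mull.
rewrite negbK in id; rewrite id /trace_spec f1; last exact: id.
set f := (d %/ i)%N; have Ed : d = (i * f)%N by rewrite mulnC divnK.
have f_gt0 : (0 < f)%N by rewrite divn_gt0 // dvdn_leq.
have fs : (f %| s.+1)%N by rewrite -(dvdn_pmul2r i_gt0) mulnC -Ed.
have gE : (s.+1 %/ f)%N = g by rewrite /g Ed mulnC divnMl.
rewrite fs gE -tAq_comp.
have Hd j : (i %| j)%N -> (tAq d g)`_j = i%:R ^+ g.-1 * (tAq f g)`_(j %/ i).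
  by move=> ij; rewrite -coef_tAq_mul // -Ed mulnC divnK.
rewrite /P; move: (tAq d g) (tAq f g) Hd => T T' Hd {P}.
apply/polyP => j; rewrite !coefCM coef_sum coefD coef_comp_poly_Xn //.
have P0 : ((g == 1%N)%:R : {poly rat})`_j = (g == 1%N)%:R * (j == 0%N)%:R.
  by rewrite -(rmorph_nat (@polyC rat)) coefC; case: eqP; rewrite ?mulr1 ?mulr0.
case: (boolP (i %| j)%N) => [ij|nij]; last first.
  rewrite add0r P0; have -> : (j == 0%N) = false by apply: contraNF nij => /eqP->.
  rewrite mulr0 mulr0 big1 ?mulr0 // => p ps; rewrite coef_gcd_part.
  case: eqP => // E; case/negP: nij.
  by rewrite (@dvdn_trans (gcdn j d)) ?dvdn_gcdl // E dvdn_mull.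
have /dvdnP[e ei] : (i %| gcdn j d)%N by rewrite dvdn_gcd ij id.
have e_gt0 : (0 < e)%N.
  have : (0 < gcdn j d)%N by rewrite gcdn_gt0 d_gt0 orbT.
  by rewrite ei muln_gt0 => /andP[].
have es : (e %| s.+1)%N.
  apply: dvdn_trans fs; rewrite -(dvdn_pmul2r i_gt0) -ei [X in (_ %| X)%N]mulnC -Ed.
  exact: dvdn_gcdr.
(* The only summand containing the exponent j is the one with p + 1 = (s + 1) / e. *)
have [q Es] := dvdnP es.
have q_gt0 : (0 < q)%N by move: (ltn0Sn s); rewrite Es muln_gt0 => /andP[].
have qE : (s.+1 %/ q = e)%N by rewrite Es mulKn.
have p0_lt : (q.-1 < s.+1)%N by rewrite prednK // Es leq_pmulr.
have p0E : q.-1.+1 = q by rewrite prednK.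
rewrite (bigD1 (Ordinal p0_lt)) /= p0E; last by rewrite Es dvdn_mulr.
rewrite qE coef_gcd_part ei eqxx big1 ?addr0 => [|p /andP[ps pp0]]; last first.
  rewrite coef_gcd_part; rewrite ei; case: eqP => // E; case/eqP: pp0; apply: val_inj => /=.
  have Ee : e = (s.+1 %/ p.+1)%N by apply/eqP; rewrite -(eqn_pmul2r i_gt0) E.
  apply: succn_inj; rewrite p0E; apply/eqP; rewrite -(eqn_pmul2r e_gt0) -Es Ee.
  by rewrite mulnC divnK.
rewrite coefD P0 Hd // /C Ed.
have F0 : g`!%:R != 0 :> rat by rewrite pnatr_eq0 -lt0n fact_gt0.
have f0 : f%:R != 0 :> rat by rewrite pnatr_eq0 -lt0n.
have i0 : i%:R != 0 :> rat by rewrite pnatr_eq0 -lt0n.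
rewrite expnMn !natrM !natrX; move: (T'`_(j %/ i)) => w.
move: g_gt0 F0; clearbody g f; clear - i0 f0; case: g => // g _ F0 /=.
(* The constant correction tolerates the scaling by i^(g-1), which is 1 where the correction is not
   zero. *)
have E : (g.+1 == 1%N)%:R * (j == 0%N)%:R = i%:R ^+ g * ((g.+1 == 1%N)%:R * (j == 0%N)%:R) :> rat.
  by case: g {F0} => [|g]; rewrite ?expr0 ?mul1r ?mul0r ?mulr0.
rewrite [in RHS]E !exprS; move: (_ * (j == 0%N)%:R) => v {E}.
move: (i%:R : rat) (f%:R : rat) i0 f0 => x y x0 y0.
move: (x ^+ g) (y ^+ g) (expf_neq0 g x0) (expf_neq0 g y0) => X Y X0 Y0.
move: (g.+1`!%:R : rat) F0 (s.+1%:R : rat) => z z0 S.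
by field; rewrite x0 y0 X0 Y0 z0.
Qed.

Section Specialize.
Variable d : nat.
Hypothesis d_gt0 : (0 < d)%N.

Definition primF s i : tfam := fun N => primsum s (letter_weight (@xvar N) 'X) i.

Lemma pexp_primF s i : (0 < i)%N -> pexp d (i * s.+1)%N (primF s i) (prim_spec d s i).
Proof.
elim/ltn_ind: s i => s IH i i_gt0.
have rest : pexp d (i * s.+1)%N
    (fun N => \sum_(p < s.+1 | (p.+1 %| s.+1)%N && (p != ord_max))
       primF p (s.+1 %/ p.+1 * i) N)
    (\sum_(p < s.+1 | (p.+1 %| s.+1)%N && (p != ord_max))
       prim_spec d p (s.+1 %/ p.+1 * i)).
  apply: pexp_sum => p /andP[ps pmax].
  have -> : (i * s.+1 = s.+1 %/ p.+1 * i * p.+1)%N.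
    by rewrite -mulnA [(i * p.+1)%N]mulnC mulnA divnK // mulnC.
  apply: IH; last by rewrite muln_gt0 i_gt0 divn_gt0 // dvdn_leq.
  rewrite ltn_neqAle -ltnS ltn_ord andbT.
  by apply: contraNneq pmax => E; apply/eqP/val_inj.
apply: pexp_ext (pexpD (pexp_wordF i_gt0 d_gt0 s) (pexpN rest)) => [N|].
  rewrite /wordF wordsum_primsum (bigD1 ord_max) //= divnn mul1n addrK.
  by [].
rewrite trace_spec_prim_spec // (bigD1 ord_max) //= divnn mul1n addrK.
by [].
Qed.

Variables (s B : nat) (h : nat -> {poly rat}).
Hypothesis h0 : h 0 = 1.
Hypothesis hS : forall m, (s.+1 * m)%N%:R * h m =
  \sum_(i < m) prim_spec d s i.+1 * h (m - i.+1)%N.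

Definition multisetF m : tfam := fun N =>
  \sum_(mu in wmultisets N s B m) multiset_weight (letter_weight (@xvar N) 'X) mu.

Lemma pexp_multisetF m : (s.+1 * m <= B)%N -> pexp d (s.+1 * m)%N (multisetF m) (h m).
Proof.
elim/ltn_ind: m => -[|m] IH mB.
  rewrite muln0; apply: pexp_ext (pexp1 d) => // N.
  by rewrite /multisetF wmultisets0.
have H : pexp d (s.+1 * m.+1)%N
    (fun N => \sum_(i < m.+1) primF s i.+1 N * multisetF (m.+1 - i.+1) N)
    (\sum_(i < m.+1) prim_spec d s i.+1 * h (m.+1 - i.+1)%N).
  apply: pexp_sum => i _.
  have -> : (s.+1 * m.+1 = i.+1 * s.+1 + s.+1 * (m.+1 - i.+1))%N.
    by rewrite [(i.+1 * _)%N]mulnC -mulnDr; congr muln; have := ltn_ord i; lia.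
  apply: pexpM; first exact: pexp_primF.
  apply: IH; first by rewrite subSS ltnS leq_subr.
  by apply: leq_trans mB; rewrite leq_mul2l leq_subr orbT.
have gt0 : (0 < s.+1 * m.+1)%N by [].
have {}H : pexp d (s.+1 * m.+1)%N (fun N => (s.+1 * m.+1)%N%:R * multisetF m.+1 N)
    (\sum_(i < m.+1) prim_spec d s i.+1 * h (m.+1 - i.+1)%N).
  by apply: pexp_ext H => // N; rewrite /multisetF wmultisets_newton.
apply: pexp_ext (pexp_divn gt0 H) => //.
rewrite -hS mulrA -(rmorph_nat (@polyC rat)) -polyCM mulVf ?mul1r //.
by rewrite pnatr_eq0 -lt0n.
Qed.

End Specialize.

(** * Sums over partitions *)

Lemma sumn_count_leq (mu : seq nat) i : (0 < i)%N -> (sumn mu < i)%N -> count_mem i mu = 0%N.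
Proof.
move=> i0 lt; apply/count_memPn; apply: contraTN lt => i_mu; rewrite -leqNgt.
by elim: mu i_mu => //= a mu IH; rewrite inE => /orP[/eqP ->|/IH]; lia.
Qed.

Lemma prod_parts_widen (F : nat -> nat -> nat) mu S : (sumn mu <= S)%N ->
  (forall i, F i 0%N = 1%N) ->
  (\prod_(1 <= i < (sumn mu).+1) F i (count_mem i mu) =
   \prod_(1 <= i < S.+1) F i (count_mem i mu))%N.
Proof.
move=> le F0; rewrite [RHS](big_cat_nat _ (n := (sumn mu).+1)) //= [X in (_ * X)%N]big_nat_cond.
rewrite [X in (_ * X)%N]big1 ?muln1 // => i /andP[/andP[lt _] _].
by rewrite sumn_count_leq // (leq_trans _ lt).
Qed.

Lemma prod_fact_count_undup mu S : 0%N \notin mu -> (sumn mu <= S)%N ->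
  (\prod_(1 <= i < S.+1) (count_mem i mu)`! =
   \prod_(i <- undup mu) (count_mem i mu)`!)%N.
Proof.
move=> mu0 le; rewrite (bigID (fun i => i \in mu)) /= [X in (_ * X)%N]big1 ?muln1; last first.
  by move=> i /count_memPn ->.
rewrite -big_filter; apply: perm_big; apply: uniq_perm; rewrite ?undup_uniq //.
  by rewrite filter_uniq ?iota_uniq.
move=> i; rewrite mem_filter mem_undup mem_index_iota andb_idr // => i_mu.
rewrite lt0n; have -> : i != 0%N by apply: contraTneq i_mu => ->.
rewrite /= ltnS leqNgt; apply/negP => lt; move: i_mu; rewrite -has_pred1 has_count.
by rewrite sumn_count_leq // (leq_ltn_trans _ lt).
Qed.

Lemma prod_parts_count mu S : 0%N \notin mu -> (sumn mu <= S)%N ->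
  (\prod_(1 <= i < S.+1) i ^ count_mem i mu = \prod_(a <- mu) a)%N.
Proof.
elim: mu => [|a mu IH] mu0 /= le; first by rewrite big_nil big1.
rewrite inE negb_or in mu0; have /andP[a0 mu0'] := mu0.
have aS : a \in index_iota 1 S.+1 by rewrite mem_index_iota lt0n eq_sym a0 ltnS; lia.
rewrite big_cons -IH //; last by lia.
rewrite (bigD1_seq a) ?iota_uniq //= [in RHS](bigD1_seq a) ?iota_uniq //= eqxx expnS -mulnA.
congr (_ * (_ * _))%N; apply: eq_bigr => i ia.
by rewrite eq_sym (negbTE ia).
Qed.

Lemma zeeE mu : 0%N \notin mu -> zee mu =
  ((\prod_(a <- mu) a) * \prod_(1 <= i < (sumn mu).+1) (count_mem i mu)`!)%N.
Proof. by move=> mu0; rewrite /zee big_split /= prod_parts_count. Qed.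

Lemma zee_gt0 mu : (0 < zee mu)%N.
Proof.
rewrite /zee big_nat_cond prodn_cond_gt0 // => i /andP[/andP[i0 _] _].
by rewrite muln_gt0 expn_gt0 i0 fact_gt0.
Qed.

Lemma perm_zee mu nu : perm_eq mu nu -> zee mu = zee nu.
Proof.
move=> p; rewrite /zee (perm_sumn p); apply: eq_bigr => i _.
by rewrite (seq.permP p).
Qed.

Lemma zee_cons a mu : (0 < a)%N -> zee (a :: mu) = (a * (count_mem a mu).+1 * zee mu)%N.
Proof.
move=> a0; pose F (i c : nat) := (i ^ c * c`!)%N.
have F0 i : F i 0%N = 1%N by [].
rewrite /zee (prod_parts_widen (F := F) (mu := mu) (S := a + sumn mu)) ?leq_addl //=.
have aS : a \in index_iota 1 (a + sumn mu).+1 by rewrite mem_index_iota a0 ltnS leq_addr.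
rewrite (bigD1_seq a) ?iota_uniq //= [in RHS](bigD1_seq a) ?iota_uniq //= eqxx mulnA.
congr (_ * _)%N; first by rewrite /F add1n expnS factS; ring.
by apply: eq_bigr => i ia; rewrite eq_sym (negbTE ia).
Qed.

Lemma sumn_counts mu m : 0%N \notin mu -> sumn mu = m ->
  m = (\sum_(i < m) i.+1 * count_mem i.+1 mu)%N.
Proof.
move=> mu0 Em; rewrite -{1}Em.
suff H S : (sumn mu <= S)%N -> sumn mu = (\sum_(i < S) i.+1 * count_mem i.+1 mu)%N.
  by apply: H; rewrite Em.
elim: mu mu0 {Em} => [|a mu IH] mu0 le; first by rewrite big1 // => i _; rewrite muln0.
rewrite inE negb_or in mu0; have /andP[a0 mu0'] := mu0; rewrite /= in le *.
rewrite (eq_bigr (fun i : 'I_S => (i.+1 == a) * a + i.+1 * count_mem i.+1 mu)%N); last first.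
  by move=> i _; rewrite mulnDr eq_sym; case: eqP => [->|_]; rewrite ?muln1 ?mul1n ?muln0.
rewrite big_split /= -IH //; last by lia.
congr (_ + _)%N; have lt : (a.-1 < S)%N by lia.
rewrite (bigD1 (Ordinal lt)) //= big1 ?addn0; last first.
  by move=> i; rewrite -val_eqE /= => ne; have -> : (i.+1 == a) = false by lia.
have -> : (a.-1.+1 == a) by lia.
by rewrite mul1n.
Qed.

Section PartitionSum.
Variable q : nat -> {poly rat}.

Definition partsum m : {poly rat} :=
  \sum_(mu <- partns m) ((zee mu)%:R^-1)%:P * \prod_(a <- mu) q a.

Lemma partsum0 : partsum 0 = 1.
Proof.
rewrite /partsum (perm_big [:: [::]]) /=; last first.
  apply: uniq_perm; rewrite ?partns_uniq // => mu; rewrite mem_partns inE /is_partn.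
  case: mu => [|a mu] //=; rewrite inE.
  by apply/negbTE/negP => /and3P[_ ]; rewrite negb_or; lia.
by rewrite big_seq1 big_nil /zee big_nil invr1 mulr1.
Qed.

Lemma partns_insert m a : (0 < a <= m)%N ->
  perm_eq [seq mu <- partns m | a \in mu]
    [seq sort geq (a :: nu) | nu <- partns (m - a)].
Proof.
move=> /andP[a0 am].
have tot : total geq by move=> x y; exact: leq_total.
have tr : transitive geq by move=> x y z xy yz; exact: leq_trans yz xy.
have asym : antisymmetric geq by move=> x y; rewrite andbC => /anti_leq.
apply: uniq_perm; first by rewrite filter_uniq ?partns_uniq.
  rewrite map_inj_in_uniq ?partns_uniq // => nu nu'; rewrite !mem_partns.
  move=> /and3P[s1 _ _] /and3P[s2 _ _] E.
  apply: (sorted_eq tr asym) => //; rewrite -(perm_cons a).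
  by rewrite -(perm_sort geq) E perm_sort.
move=> mu; rewrite mem_filter mem_partns; apply/idP/mapP.
  move=> /andP[amu /and3P[s mu0 /eqP Em]]; exists (rem a mu).
    rewrite mem_partns; apply/and3P; split; first exact: subseq_sorted (rem_subseq _ _) s.
      by apply: contra mu0 => /mem_rem.
    by have := perm_sumn (perm_to_rem amu); rewrite /= Em; lia.
  apply: (sorted_eq tr asym) => //; first exact: sort_sorted.
  by rewrite (perm_trans (perm_to_rem amu)) // perm_sym perm_sort.
move=> [nu]; rewrite mem_partns => /and3P[s nu0 /eqP En] ->.
rewrite mem_sort mem_head /=; apply/and3P; split; first exact: sort_sorted.
  by rewrite mem_sort inE negb_or nu0 andbT eq_sym -lt0n.
by rewrite (perm_sumn (permEl (perm_sort geq (a :: nu)))) /= En subnKC.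
Qed.

(** The factor m is distributed as the sum over i of i times the multiplicity of i in mu, and one
    part i is deleted; by [zee_cons] this weight is exactly the quotient of the two values of
    [zee]. *)
Lemma partsum_rec m : m%:R * partsum m = \sum_(i < m) q i.+1 * partsum (m - i.+1).
Proof.
rewrite /partsum mulr_sumr big_seq_cond.
rewrite (eq_bigr (fun mu => \sum_(i < m) (i.+1 * count_mem i.+1 mu)%N%:R *
    (((zee mu)%:R^-1)%:P * \prod_(a <- mu) q a))); last first.
  move=> mu /andP[]; rewrite mem_partns => /and3P[_ mu0 /eqP Em] _.
  by rewrite -mulr_suml -natr_sum -sumn_counts.
rewrite -big_seq_cond exchange_big /=; apply: eq_bigr => i _.
rewrite (bigID (fun mu : seq nat => i.+1 \in mu)) /= [X in _ + X]big1 ?addr0; last first.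
  by move=> mu /count_memPn ->; rewrite muln0 mul0r.
rewrite -big_filter (perm_big _ (partns_insert _)) /=; last by have := ltn_ord i; lia.
rewrite big_map mulr_sumr; apply: eq_bigr => nu _.
have p : perm_eq (sort geq (i.+1 :: nu)) (i.+1 :: nu) by rewrite perm_sort.
rewrite (perm_zee p) (perm_big _ p) /= (seq.permP p) /= eqxx add1n big_cons zee_cons //.
set z := zee nu; set c := count _ nu.
have z0 : z%:R != 0 :> rat by rewrite pnatr_eq0 -lt0n zee_gt0.
have E : (i.+1 * c.+1)%N%:R * ((i.+1 * c.+1 * z)%N%:R)^-1 = z%:R^-1 :> rat.
  by rewrite [(_ * z)%:R]natrM invfM mulrA mulfV ?mul1r // pnatr_eq0.
by rewrite mulrA -(rmorph_nat (@polyC rat)) -polyCM E; ring.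
Qed.

End PartitionSum.

(** * The coefficients chi *)

(* The (n+1)-st power sum is adjusted, without changing the previous ones, by
   adding the multiples of all (n+1)-st roots of unity. *)
Lemma exists_powersums n (v : nat -> algC) : exists xs : seq algC,
  forall i, (0 < i <= n)%N -> \sum_(x <- xs) x ^+ i = v i.
Proof.
elim: n => [|n [xs IH]]; first by exists [::] => i; lia.
have [z zP] := C_prim_root_exists (ltn0Sn n).
pose e := v n.+1 - \sum_(x <- xs) x ^+ n.+1.
(* The n + 1 numbers c z^j have (n+1)-st powers adding up to (n + 1) c^(n+1) = e, the missing
   amount. *)
pose c := (n.+1).-root (e / n.+1%:R).
exists (xs ++ [seq c * z ^+ j | j <- iota 0 n.+1]) => i /andP[i0 le].
have sumE : \sum_(x <- [seq c * z ^+ j | j <- iota 0 n.+1]) x ^+ i =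
    c ^+ i * \sum_(j < n.+1) (z ^+ i) ^+ j.
  rewrite big_map -[iota 0 n.+1]/(index_iota 0 n.+1) big_mkord mulr_sumr.
  by apply: eq_bigr => j _; rewrite exprMn -!exprM mulnC.
rewrite big_cat /= sumE; move: le; rewrite leq_eqVlt => /orP[/eqP ->|lt].
  rewrite (prim_expr_order zP); have -> : \sum_(j < n.+1) (1 : algC) ^+ j = n.+1%:R.
    by under eq_bigr do rewrite expr1n; rewrite sumr_const card_ord.
  rewrite rootCK // mulfVK ?pnatr_eq0 // /e addrC subrK.
  by [].
have zi : z ^+ i - 1 != 0.
  rewrite subr_eq0 -(prim_order_dvd zP); apply/negP => /dvdn_leq; lia.
have -> : \sum_(j < n.+1) (z ^+ i) ^+ j = 0.
  apply: (mulfI zi); rewrite -subrX1 mulr0 -exprM mulnC exprM (prim_expr_order zP).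
  by rewrite expr1n subrr.
by rewrite mulr0 addr0 IH // i0 -ltnS.
Qed.

Lemma all_pred1_partn d k (nu : seq nat) : (0 < d)%N -> sumn nu = (d * k)%N ->
  all (pred1 d) nu = (sort geq nu == nseq k d).
Proof.
move=> d0 Es; apply/idP/eqP => [al|E].
  have {}al : all (pred1 d) (sort geq nu) by rewrite all_sort.
  move/all_pred1P: (al) => ->; congr nseq.
  have : sumn (sort geq nu) = (d * k)%N.
    by rewrite (perm_sumn (permEl (perm_sort geq nu))).
  move/all_pred1P: al => ->; rewrite sumn_nseq size_nseq => /eqP.
  by rewrite eqn_pmul2l // => /eqP.
by rewrite -(all_sort _ geq) E all_pred1_nseq.
Qed.

(** One evaluation isolates the coefficient at d^k: at algebraic numbers whose power sums up to n
    are 1 at d and 0 elsewhere, p_nu vanishes for every other partition nu of n. *)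
Lemma pexpansion_unique d k n (F : qfun) c c' : (0 < d)%N -> n = (d * k)%N ->
  is_pexpansion n F c -> is_pexpansion n F c' -> c (nseq k d) = c' (nseq k d).
Proof.
move=> d0 En Hc Hc'.
have [xs Hx] := exists_powersums n (fun i => (i == d)%:R).
pose N := size xs; pose x (i : 'I_N) := xs`_i.
pose ev := mmap (ratr : rat -> algC) x.
have evp nu : nu \in partns n -> ev (psum nu N) = (nu == nseq k d)%:R.
  rewrite mem_partns => /and3P[s nu0 /eqP Es].
  have -> : (nu == nseq k d) = all (pred1 d) nu.
    rewrite (@all_pred1_partn d k) ?Es // sorted_sort // => a b e ab be.
    exact: leq_trans be ab.
  have le : all (fun a => (0 < a <= n)%N) nu.
    apply/allP => a a_nu; apply/andP; split; first by rewrite lt0n; apply: contraNneq nu0 => <-.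
    rewrite leqNgt; apply/negP => lt; have := sumn_count_leq (leq_ltn_trans (leq0n _) lt).
    by rewrite -Es in lt; move/(_ _ lt)/eqP; rewrite -leqn0 leqNgt -has_count has_pred1 a_nu.
  rewrite /ev /psum rmorph_prod /=; elim: nu {s nu0 Es} le => [|a nu IH] /=.
    by rewrite big_nil.
  move=> /andP[la le]; rewrite big_cons IH // rmorph_sum /=.
  have -> : \sum_(i < N) mmap ratr x ('X_i ^+ a) = (a == d)%:R.
    rewrite -(Hx a la) (big_nth 0) big_mkord; apply: eq_bigr => i _.
    by rewrite rmorphXn /= mmapX mmap1U.
  by case: (a == d); rewrite ?mul0r ?mul1r.
have evF e : is_pexpansion n F e ->
    ev (F N) = ratr (e (nseq k d) / (zee (nseq k d))%:R).
  move=> He; rewrite He /ev rmorph_sum /= (bigD1_seq (nseq k d)) ?partns_uniq //=; last first.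
    rewrite mem_partns /is_partn sumn_nseq En eqxx andbT; apply/andP; split; last first.
      by rewrite mem_nseq negb_and orbC; case: d d0 {En evp Hx}.
    by elim: k {En evp} => //= k; case: k => //= k ->; rewrite leqnn.
  rewrite mmapZ -/ev evp; last first.
    rewrite mem_partns /is_partn sumn_nseq En eqxx andbT; apply/andP; split; last first.
      by rewrite mem_nseq negb_and orbC; case: d d0 {En evp Hx}.
    by elim: k {En evp} => //= k; case: k => //= k ->; rewrite leqnn.
  rewrite eqxx mulr1 big_seq_cond big1 ?addr0 // => nu /andP[nuP ne].
  by rewrite /ev mmapZ -/ev evp // (negbTE ne) mulr0.
have := evF _ Hc; rewrite (evF _ Hc') => /fmorph_inj/divIf -> //.
by rewrite pnatr_eq0 -lt0n zee_gt0.
Qed.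

(** The list behind [pexp] is the same for all N, so collecting its terms by sorted index gives an
    expansion in the sense of [chi]. This existence makes [epsilon] return an expansion, which
    uniqueness then compares at d^k. *)
Lemma chi_pexp d k n (F : nat -> qfun) (T : tfam) a : (0 < d)%N -> n = (d * k)%N ->
  (forall N j, (T N)`_j = F j N) -> pexp d n T a ->
  forall j, chi n (F j) (nseq k d) = (zee (nseq k d))%:R * a`_j.
Proof.
move=> d0 En HT [l [H1 H2 H3]] j.
pose c nu : rat := (zee nu)%:R * \sum_(q <- l | sort geq q.2 == nu) (q.1)`_j.
have cE : is_pexpansion n (F j) c.
  move=> N; rewrite -HT H2 coef_sum.
  under [RHS]eq_bigr => nu _.
    rewrite /c mulrAC mulfV ?pnatr_eq0 -?lt0n ?zee_gt0 // mul1r scaler_suml.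
    over.
  rewrite (exchange_big_dep predT) //= big_seq_cond [RHS]big_seq_cond; apply: eq_bigr => q.
  rewrite andbT => ql; have /andP[q0 /eqP qs] := allP H1 _ ql.
  rewrite -big_filter (perm_big [:: sort geq q.2]) /=; last first.
    apply: uniq_perm; rewrite ?filter_uniq ?partns_uniq // => nu.
    rewrite mem_filter mem_seq1 eq_sym; case: eqP => // ->; rewrite mem_partns.
    rewrite /is_partn mem_sort q0 (perm_sumn (permEl (perm_sort geq q.2))) qs eqxx !andbT.
    by rewrite sort_sorted // => x y; exact: leq_total.
  rewrite big_seq1 coefMC coef_map /= mul_mpolyC; congr (_ *: _).
  by apply: perm_big; rewrite perm_sym perm_sort.
have chiE : is_pexpansion n (F j) (chi n (F j)).
  by apply: epsilon_spec; exists c.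
rewrite (pexpansion_unique d0 En chiE cE) /c H3 coef_sum; congr (_ * _).
rewrite big_seq_cond [RHS]big_seq_cond; apply: eq_bigl => q.
case: (boolP (q \in l)) => //= ql; have /andP[q0 /eqP qs] := allP H1 _ ql.
by rewrite (@all_pred1_partn d k) // qs.
Qed.

(** * The theorem *)

Definition stdF s n m : tfam := fun N =>
  \sum_(p in stdpairs N s n m) \prod_i letter_weight (@xvar N) 'X (letter_of p.1 p.2 i).

Lemma coef_stdF s n m N j : (stdF s n m N)`_j = Qeul n (nseq m s.+1) j N.
Proof.
rewrite /stdF /Qeul.
rewrite (eq_bigl (fun p : 'S_n * {ffun 'I_n -> 'I_N} =>
    (cycle_type p.1 == nseq m s.+1) && compat p.1 p.2)); last by move=> p; rewrite inE.
rewrite -(pair_big_dep (fun sg => cycle_type sg == nseq m s.+1) (@compat N n)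
  (fun sg f => \prod_i letter_weight (@xvar N) 'X (letter_of sg f i))) /= coef_sum.
rewrite [RHS](eq_bigl (fun sg => (cycle_type sg == nseq m s.+1) && (exc sg == j))); last first.
  by move=> sg; rewrite inE.
rewrite [RHS]big_mkcondr /=; apply: eq_bigr => sg _; rewrite coef_sum /Fqsym.
have term (f : {ffun 'I_n -> 'I_N}) :
    \prod_i letter_weight (@xvar N) 'X (letter_of sg f i) = (\prod_(i < n) 'X_(f i))%:P * 'X^(exc sg).
  rewrite /letter_weight big_split /= rmorph_prod; congr (_ * _).
    by apply: eq_bigr => i _; rewrite /xvar rev_ordK.
  rewrite excE -prodrXr; apply: eq_bigr => i _.
  by case: leqP => _; rewrite ?expr0 ?expr1.
under eq_bigr do rewrite term coefCM coefXn.
case: (eqVneq (exc sg) j) => [E|ne]; last by rewrite big1 // => f _; rewrite mulr0.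
by apply: eq_bigr => f _; rewrite mulr1.
Qed.

Lemma exc_lt n (sg : 'S_n) : (0 < n)%N -> (exc sg < n)%N.
Proof.
case: n sg => // n sg _; rewrite /exc -[X in (_ < X)%N]card_ord -cardsT; apply: proper_card.
apply/properP; split; first exact: subsetT.
by exists ord_max; rewrite ?inE // -leqNgt -ltnS.
Qed.

Lemma chi_eq0 d k n (F : qfun) : (0 < d)%N -> n = (d * k)%N ->
  (forall N, F N = 0) -> chi n F (nseq k d) = 0.
Proof.
move=> d0 En F0; have H0 : is_pexpansion n F (fun=> 0).
  by move=> N; rewrite F0 big1 // => nu _; rewrite mul0r scale0r.
have H : is_pexpansion n F (chi n F) by apply: epsilon_spec; exists (fun=> 0).
exact: pexpansion_unique d0 En H H0.
Qed.

Lemma zee_nseq k d : (0 < d)%N -> zee (nseq k d) = (d ^ k * k`!)%N.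
Proof.
move=> d0; elim: k => [|k IH]; first by rewrite /zee big_nil.
by rewrite zee_cons // IH count_nseq /= eqxx mul1n expnS factS; ring.
Qed.

(** A primitive necklace consists of s + 1 words, so [prim_spec d s i] divided by s + 1 is the value
    of p_i[L_r]; the factor d^k k! is [zee] of d^k. *)
Lemma sum_chi s n m d k : (0 < s)%N -> n = (s.+1 * m)%N -> (0 < n)%N ->
    (0 < d)%N -> n = (d * k)%N ->
  \sum_(j < n) chi n (Qeul n (nseq m s.+1) j) (nseq k d) *: 'X^j =
  (d ^ k * k`!)%N%:R *: partsum (fun i => (s.+1%:R^-1)%:P * prim_spec d s i) m.
Proof.
move=> s0 En n0 d0 Ek; set q : nat -> {poly rat} := fun i => _%:P * _; set h := partsum q.
have s1 : s.+1%:R != 0 :> rat by rewrite pnatr_eq0.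
have pe : pexp d n (stdF s n m) (h m).
  have := @pexp_multisetF d d0 s n h (partsum0 q) _ m; rewrite -En => H.
  apply: pexp_ext (H _ (leqnn n)) => // [N|m'].
    by rewrite /multisetF /stdF sum_stdpairs.
  rewrite natrM -mulrA partsum_rec mulr_sumr; apply: eq_bigr => i _.
  rewrite /q -(rmorph_nat (@polyC rat)) !mulrA -polyCM mulfV // mul1r.
  by [].
have chiE := chi_pexp d0 Ek (fun N j => coef_stdF s n m N j) pe.
rewrite (eq_bigr (fun j : 'I_n => ((d ^ k * k`!)%N%:R * (h m)`_j) *: 'X^j)); last first.
  by move=> j _; rewrite (chiE j) zee_nseq.
rewrite -(poly_def n (fun j => (d ^ k * k`!)%N%:R * (h m)`_j)).
apply/polyP => j; rewrite coef_poly coefZ; case: ltnP => // nj.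
(* No permutation of n points has n or more excedances, so the coefficients from degree n on
   vanish. *)
rewrite -zee_nseq // -chiE (chi_eq0 d0 Ek) // => N.
rewrite /Qeul big1 // => sg; rewrite inE => /andP[_ /eqP Ej].
by have := exc_lt sg n0; rewrite Ej ltnNge nj.
Qed.

Lemma prim_spec_eq0 d s i : ~~ ((i %| d) && (d %| s.+1 * i))%N -> prim_spec d s i = 0.
Proof.
rewrite negb_and /prim_spec => /orP[nid|/negbTE -> //]; case: ifP => [_|_]; last by [].
suff -> : gcd_part (tAq d (s.+1 * i %/ d) + (s.+1 * i %/ d == 1)%N%:R) d i = 0.
  exact: mulr0.
apply/polyP => j; rewrite coef_gcd_part coef0; case: eqP => [E|_]; last by [].
by case/negP: nid; rewrite -E dvdn_gcdr.
Qed.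

(** The correction at g = 1 disappears here: it sits at exponent 0, which is selected only for i =
    d, and then g = s + 1 > 1. *)
Lemma prim_spec_div d s i : (0 < s)%N -> (0 < d)%N -> (0 < i)%N ->
    (i %| d)%N -> (d %| s.+1 * i)%N ->
  let g := (s.+1 * i %/ d)%N in (s.+1%:R^-1)%:P * prim_spec d s i =
  (i%:R / (d ^ g * g`!)%N%:R)%:P * gcd_part (tAq d g) d i.
Proof.
move=> s0 d0 i0 id ds g; rewrite /prim_spec ds -/g mulrA -polyCM.
have -> : s.+1%:R^-1 * ((s.+1 * i)%N%:R / (d ^ g * g`!)%N%:R) =
    i%:R / (d ^ g * g`!)%N%:R :> rat.
  by rewrite natrM !mulrA mulVf ?mul1r // pnatr_eq0.
congr (_ * _); apply/polyP => j; rewrite !coef_gcd_part coefD.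
case: eqP => [E|_]; last by [].
have -> : ((g == 1%N)%:R : {poly rat})`_j = 0; last by rewrite addr0.
rewrite -(rmorph_nat (@polyC rat)) coefC; case: eqP => [j0|_]; last by [].
rewrite j0 gcd0n in E; rewrite /g -E mulnK //.
by case: s s0 {ds g}.
Qed.

(** Scaling by r / d is injective on the parts, so multiplicities are kept, and the scaled parts add
    up to k, so the powers of d cancel. The numerators a cancel the product of the parts in
    [zee mu]. *)
Lemma ppi_zee m d k r mu : (0 < d)%N -> (0 < r)%N -> (r * m = d * k)%N ->
    is_partn m mu -> all (fun a => (a %| d) && (d %| r * a))%N mu ->
  (d ^ k * k`!)%N%:R / (zee mu)%:R *
    \prod_(a <- mu) (a%:R / (d ^ (r * a %/ d) * (r * a %/ d)`!)%N%:R) =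
  ppi [seq (r * a %/ d)%N | a <- mu].
Proof.
move=> d0 r0 Ek /and3P[_ mu0 /eqP Em] al; pose g a := (r * a %/ d)%N.
have gd a : a \in mu -> (d * g a = r * a)%N.
  by move=> /(allP al)/andP[_ da]; rewrite mulnC divnK.
have ginj : {in mu &, injective g}.
  move=> a b amu bmu E; apply/eqP; rewrite -(eqn_pmul2l r0) -!gd //.
  by rewrite E.
set nu := [seq _ | a <- mu].
have nuk : sumn nu = k.
  apply/eqP; rewrite -(eqn_pmul2l d0) -Ek -Em /nu; apply/eqP.
  rewrite !sumnE big_map !big_distrr /= big_seq [RHS]big_seq.
  by apply: eq_bigr => a /gd.
have nu0 : 0%N \notin nu.
  apply/negP => /mapP[a amu E]; have := gd a amu; rewrite /g -E muln0 => /esym/eqP.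
  rewrite muln_eq0 gtn_eqF //= => /eqP a0; move: mu0; rewrite -a0 amu.
  by [].
have counts : (\prod_(1 <= j < k.+1) (count_mem j nu)`! =
    \prod_(1 <= i < m.+1) (count_mem i mu)`!)%N.
  rewrite !prod_fact_count_undup ?nuk ?Em //.
  rewrite (perm_big [seq g a | a <- undup mu]) /=; last first.
    apply: uniq_perm; rewrite ?undup_uniq //.
      rewrite map_inj_in_uniq ?undup_uniq // => a b; rewrite !mem_undup; exact: ginj.
    move=> b; rewrite mem_undup; apply/mapP/mapP => -[a amu ->]; exists a => //.
      by rewrite mem_undup.
    by rewrite mem_undup in amu.
  rewrite big_map big_seq [RHS]big_seq; apply: eq_bigr => a; rewrite mem_undup => amu.
  congr (_`!); rewrite count_map; apply: eq_in_count => b bmu /=.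
  by rewrite (inj_in_eq ginj).
have -> : \prod_(a <- mu) (a%:R / (d ^ g a * (g a)`!)%N%:R) =
   (\prod_(a <- mu) a)%N%:R / (d ^ k * \prod_(a <- mu) (g a)`!)%N%:R :> rat.
  rewrite prodf_div -!natr_prod; congr (_ / _%:R); rewrite big_split /=; congr muln.
  by rewrite -expn_sum -nuk sumnE big_map.
rewrite /ppi nuk big_map zeeE // Em counts !natrM.
set P := (\prod_(a <- mu) a)%N; set C := (\prod_(1 <= i < m.+1) _)%N.
set G := (\prod_(j <- mu) _)%N.
have P0 : P%:R != 0 :> rat.
  rewrite pnatr_eq0 -lt0n /P big_seq prodn_cond_gt0 // => a amu.
  by rewrite lt0n; apply: contraNneq mu0 => <-.
have C0 : C%:R != 0 :> rat.
  by rewrite pnatr_eq0 -lt0n prodn_gt0 // => i; exact: fact_gt0.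
have G0 : G%:R != 0 :> rat.
  by rewrite pnatr_eq0 -lt0n prodn_gt0 // => i; exact: fact_gt0.
have D0 : (d ^ k)%:R != 0 :> rat by rewrite pnatr_eq0 -lt0n expn_gt0 d0.
move: (P%:R : rat) (C%:R : rat) (G%:R : rat) ((d ^ k)%:R : rat) (k`!%:R : rat) P0 C0 G0 D0.
by move=> p c e x y p0 c0 e0 x0; field; rewrite p0 c0 e0 x0.
Qed.

Lemma partsum_Par s m d k : (0 < s)%N -> (0 < d)%N -> (s.+1 * m = d * k)%N ->
  (d ^ k * k`!)%N%:R *: partsum (fun i => (s.+1%:R^-1)%:P * prim_spec d s i) m =
  \sum_(mu <- Par m d s.+1)
     ppi [seq (s.+1 * a %/ d)%N | a <- mu] *:
     \prod_(a <- mu) gcd_part (tAq d (s.+1 * a %/ d)) d a.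
Proof.
move=> s0 d0 Ek; rewrite /partsum /Par big_filter scaler_sumr [RHS]big_mkcond.
rewrite big_seq [RHS]big_seq; apply: eq_bigr => mu; rewrite mem_partns => muP.
case: ifP => [al|/negbT/allPn[a amu na]]; last first.
  have -> : \prod_(b <- mu) ((s.+1%:R^-1)%:P * prim_spec d s b) = 0.
    by rewrite (big_rem a) //= prim_spec_eq0 // mulr0 mul0r.
  by rewrite mulr0 scaler0.
rewrite -(ppi_zee d0 (ltn0Sn s) Ek muP al) -!mul_polyC mulrA -polyCM.
rewrite [in RHS]polyCM -[RHS]mulrA; congr (_ * _).
rewrite rmorph_prod -big_split /= big_seq [RHS]big_seq; apply: eq_bigr => a amu.
have /andP[ad da] := allP al _ amu; have /and3P[_ mu0 _] := muP.
by rewrite prim_spec_div // lt0n; apply: contraNneq mu0 => <-.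
Qed.

Theorem theorem5p2 (n r m d k : nat) (n_gt0 : (0 < n)%N) (r_gt1 : (1 < r)%N)
    (m_gt0 : (0 < m)%N) (d_gt0 : (0 < d)%N) (k_gt0 : (0 < k)%N)
    (n_rm : n = (r * m)%N) (n_dk : n = (d * k)%N) :
  \sum_(j < n) chi n (Qeul n (nseq m r) j) (nseq k d) *: 'X^j =
  \sum_(mu <- Par m d r)
     ppi [seq (r * a %/ d)%N | a <- mu] *:
     \prod_(a <- mu)
        gcd_part ('X * eulerian (r * a %/ d).-1 * tint d ^+ (r * a %/ d)) d a.
Proof.
case: r r_gt1 n_rm => [//|s]; rewrite ltnS => s_gt0 n_rm.
rewrite sum_chi //; apply: partsum_Par => //.
by rewrite -n_rm n_dk.
Qed.
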